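(* There exists an $O(n^4)$-time TSP-domination algorithm which has domination ratio at least $1-6n^{-2\varepsilon}$ for every $(n,d,r,\varepsilon)$-dense instance $(n,w)$ of TSP.
   Context: $K_n=(V_n,E_n)$ is the complete graph on $n$ vertices, $\mathcal H_n$ its set of (undirected) Hamilton cycles; $w(G)=\sum_{e\in E(G)}w(e)$; a $\{0,1\}$-instance has $w:E_n\to\{0,1\}$. An optimal matching of $K_n$ is any set of $\lfloor n/2\rfloor$ pairwise disjoint edges. A TSP-domination algorithm, given $(n,w)$, outputs a Hamilton cycle $H^*$; it has domination ratio at least $\rho$ for $(n,w)$ if $\mathbb{P}(w(H)<w(H^* ))\le1-\rho$ for $H$ uniform in $\mathcal H_n$. For an integer $n\ge4$, $r>0$, $d\in[0,1]$, $\varepsilon\in(0,1/2)$, a $\{0,1\}$-instance $(n,w)$ is $(n,d,r,\varepsilon)$-dense if (i) $w(K_n)=d\binom n2$ with $1-d\le1/12$; (ii) $w(M)\ge\frac12dn-r$ for every optimal matching $M$ of $K_n$; (iii) $6\bar d^2(n+1)+46r+3\bar d\le n^{1/2-\varepsilon}$, where $\bar d:=1-d$. *)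

(* Defs.v *)
From mathcomp Require Import all_boot all_fingroup.
From Stdlib Require Import Reals.

Set Implicit Arguments.
Unset Strict Implicit.
Unset Printing Implicit Defensive.

Definition is_edge (n : nat) (e : {set 'I_n}) : bool := #|e| == 2.

(* A {0,1}-instance on K_n: a weight (a boolean, i.e. 0/1) for every
   edge; the value on non-edges is irrelevant (never used). *)
Definition instance (n : nat) := {set 'I_n} -> bool.

Definition wt (n : nat) (w : instance n) (G : {set {set 'I_n}}) : nat :=
  \sum_(e in G) (w e : nat).

Definition wK (n : nat) (w : instance n) : nat :=
  \sum_(e : {set 'I_n} | is_edge e) (w e : nat).

Definition cycle_edges (n : nat) (s : {perm 'I_n}) : {set {set 'I_n}} :=
  [set [set s i; s (ordS i)] | i : 'I_n].

Definition ham_cycles (n : nat) : {set {set {set 'I_n}}} :=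
  [set E | [exists s : {perm 'I_n}, E == cycle_edges s]].

Definition optimal_matching (n : nat) (M : {set {set 'I_n}}) : Prop :=
  (forall e, e \in M -> is_edge e) /\
  #|M| = n./2 /\
  (forall e f, e \in M -> f \in M -> e != f -> [disjoint e & f]).

Definition dense (n : nat) (w : instance n) (d r eps : R) : Prop :=
  (4 <= n)%nat /\ (0 < r)%R /\ (0 <= d <= 1)%R /\ (0 < eps < 1/2)%R /\
  INR (wK w) = (d * INR 'C(n, 2))%R /\ (1 - d <= 1/12)%R /\
  (forall M, optimal_matching M -> (INR (wt w M) >= d * INR n / 2 - r)%R) /\
  (6 * (1 - d)^2 * (INR n + 1) + 46 * r + 3 * (1 - d)
     <= Rpower (INR n) (1/2 - eps))%R.

Definition domination_ratio_ge (n : nat) (w : instance n)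
    (Hstar : {set {set 'I_n}}) (rho : R) : Prop :=
  (INR #|[set H in ham_cycles n | (wt w H < wt w Hstar)%nat]|
     / INR #|ham_cycles n| <= 1 - rho)%R.

(* Machine model (unit-cost RAM) used to express running time.         *)

Inductive instr :=
| Const of nat & nat
| Add of nat & nat & nat
| Sub of nat & nat & nat
| LoadI of nat & nat
| StoreI of nat & nat
| Jz of nat & nat
| Jmp of nat
| Halt.

Definition program := seq instr.

Record state := State { pc : nat; mem : nat -> nat }.

Definition upd (m : nat -> nat) (a v : nat) : nat -> nat :=
  fun x => if x == a then v else m x.

Definition halted (P : program) (s : state) : bool :=
  if (pc s < size P)%nat then
    (if nth Halt P (pc s) is Halt then true else false)
  else true.

Definition step (P : program) (s : state) : state :=
  let m := mem s in
  let p := pc s in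
  if (p < size P)%nat then
    match nth Halt P p with
    | Const a k => State p.+1 (upd m a k)
    | Add a b c => State p.+1 (upd m a (m b + m c))
    | Sub a b c => State p.+1 (upd m a (m b - m c))
    | LoadI a b => State p.+1 (upd m a (m (m b)))
    | StoreI a b => State p.+1 (upd m (m a) (m b))
    | Jz a l => if m a == 0 then State l m else State p.+1 m
    | Jmp l => State l m
    | Halt => s
    end
  else s.

Definition run (P : program) (t : nat) (s : state) : state := iter t (step P) s.

(* Input encoding of (n,w): M[0] = n, and M[1 + i*n + j] = w({i,j})
   for distinct vertices i, j (0 on the diagonal); all other cells 0. *)
Definition enc_weight (n : nat) (w : instance n) (i j : nat) : bool :=
  [exists x : 'I_n, exists y : 'I_n,
     [&& val x == i, val y == j, x != y & w [set x; y]]].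

Definition init_mem (n : nat) (w : instance n) : nat -> nat :=
  fun a =>
    if a == 0 then n
    else if (a <= n * n)%nat then (enc_weight w ((a - 1) %/ n) ((a - 1) %% n) : nat)
    else 0.

Definition init_state (n : nat) (w : instance n) : state := State 0 (init_mem w).

(* Output convention: at halting time, cells 1 + n*n + k (k < n) hold the
   k-th vertex of the output tour.  The tour is the Hamilton cycle of the
   permutation s when these cells hold s 0, ..., s (n-1). *)
Definition outputs_perm (n : nat) (m : nat -> nat) (s : {perm 'I_n}) : Prop :=
  forall k : 'I_n, m (1 + n * n + k)%nat = val (s k).

Definition outputs_within (P : program) (n : nat) (w : instance n) (T : nat)
    (H : {set {set 'I_n}}) : Prop :=
  halted P (run P T (init_state w)) /\
  exists s : {perm 'I_n},
    outputs_perm (mem (run P T (init_state w))) s /\ H = cycle_edges s.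

(* Main.v *)
Require Import Defs.
From mathcomp Require Import all_boot all_fingroup zify.
From Stdlib Require Import Reals Lra.

Set Implicit Arguments.
Unset Strict Implicit.
Unset Printing Implicit Defensive.

(* Call an edge of weight 0 a zero edge, so that beating the output means having
   more zero edges than it.  For a threshold D let S be the set of vertices of
   zero-degree at least D.  The algorithm takes a greedy maximal matching of g
   zero edges outside S, gives every vertex of S two fresh zero-neighbours
   outside S, and concatenates the edges, the 3-vertex paths and the remaining
   vertices into a tour; it uses the least D for which the neighbours can be
   found.  The tour has at least 2|S| + g zero edges.

   Any Hamilton cycle has at most 2|S| + X zero edges, where X is the number of
   its zero edges outside S.  Those edges are covered by the 2g matched
   vertices, each of zero-degree less than D, so counting pairs of such edges
   gives P(X > g) <= E[X (X - 1)] / (g (g + 1)) <= 16 D^2 / ((n - 1) (n - 2)).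

   Condition (ii) bounds every matching of zero edges by (1 - d) n / 2 + r.  A
   failure of the greedy step at D - 1 exhibits large matchings, which bounds
   D; comparing the number of zero edges with the matching of size |S| + g bounds
   r from below when g > 0.  Condition (iii) then gives
   16 D^2 <= 6 n^(-2 eps) (n - 1) (n - 2). *)

(** * Structured programs on the RAM *)

(** The algorithm is not given d, r and eps, so it cannot compute D from them; it searches for D,
    and the failure at D - 1 is the only upper bound on D that the analysis has. With N = n^(1/2 -
    eps), that failure and (ii) give D <= (5/2) (1 - d) n + 5 r + 1, and by (iii) this is at worst
    of order sqrt(n N).

    This is why the second moment is needed. Markov's inequality for X would give 4 D / (n - 1), of
    order n^(-1/4 - eps/2), which exceeds n^(-2 eps) once eps > 1/6. The second moment gives order
    D^2 / n^2, that is n^(-1/2 - eps), which is below n^(-2 eps) because eps < 1/2.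

    To get the constant 6 for every n, a term of size n N has to be absorbed into n N^2, so N must
    be bounded below. This is the use of the lower bound on r: r >= 1/3 forces N >= 46/3. *)

Notation memory := (nat -> nat).

Inductive com :=
| Ins of instr
| Skip
| Seq of com & com
| If of nat & com & com
| Loop of com & nat & com.

Fixpoint len (c : com) : nat :=
  match c with
  | Ins _ => 1
  | Skip => 0
  | Seq c1 c2 => len c1 + len c2
  | If _ c1 c2 => (len c2 + len c1).+2
  | Loop p _ b => (len p + len b).+2
  end.

(* [If r c1 c2] runs [c1] when register [r] is zero; [Loop p r b] repeats
   [p; b] and leaves the loop right after [p] when register [r] is zero. *)
Fixpoint compile (o : nat) (c : com) : program :=
  match c with
  | Ins i => [:: i]
  | Skip => [::]
  | Seq c1 c2 => compile o c1 ++ compile (o + len c1) c2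
  | If r c1 c2 =>
      Jz r (o + len c2).+2 :: compile o.+1 c2
        ++ Jmp (o + len c2 + len c1).+2 :: compile (o + len c2).+2 c1
  | Loop p r b =>
      compile o p ++ Jz r (o + len p + len b).+2
        :: compile (o + len p).+1 b ++ [:: Jmp o]
  end.

Lemma size_compile c o : size (compile o c) = len c.
Proof.
elim: c o => [i|//|c1 IH1 c2 IH2|r c1 IH1 c2 IH2|p IHp r b IHb] o //=.
- by rewrite size_cat IH1 IH2.
- by rewrite size_cat /= IH1 IH2; lia.
- by rewrite size_cat /= size_cat /= IHp IHb; lia.
Qed.

(** Jump targets are absolute. Quantifying over the surrounding code and compiling at offset
    [size P1] makes the fragments composable. *)
Definition runs (c : com) (m : memory) (t : nat) (m' : memory) : Prop :=
  forall P1 P2 : program,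
    run (P1 ++ compile (size P1) c ++ P2) t (State (size P1) m)
    = State (size P1 + len c) m'.

Definition effect (i : instr) (m : memory) : option memory :=
  match i with
  | Const a k => Some (upd m a k)
  | Add a b c => Some (upd m a (m b + m c))
  | Defs.Sub a b c => Some (upd m a (m b - m c))
  | LoadI a b => Some (upd m a (m (m b)))
  | StoreI a b => Some (upd m (m a) (m b))
  | _ => None
  end.

Arguments run : simpl never.

Lemma run_add P t1 t2 s : run P (t1 + t2) s = run P t2 (run P t1 s).
Proof. by rewrite /run addnC iterD. Qed.

Lemma run1 P s : run P 1 s = step P s.
Proof. by []. Qed.

Lemma step_at P1 i P2 m :
  step (P1 ++ i :: P2) (State (size P1) m) =
  match i with
  | Const a k => State (size P1).+1 (upd m a k)
  | Add a b c => State (size P1).+1 (upd m a (m b + m c))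
  | Defs.Sub a b c => State (size P1).+1 (upd m a (m b - m c))
  | LoadI a b => State (size P1).+1 (upd m a (m (m b)))
  | StoreI a b => State (size P1).+1 (upd m (m a) (m b))
  | Jz a l => if m a == 0 then State l m else State (size P1).+1 m
  | Jmp l => State l m
  | Halt => State (size P1) m
  end.
Proof.
rewrite /step /= size_cat /= nth_cat ltnn subnn /=.
by have -> : (size P1 < size P1 + (size P2).+1) by lia.
Qed.

Lemma runs_ins i m m' : effect i m = Some m' -> runs (Ins i) m 1 m'.
Proof.
move=> ei P1 P2; rewrite run1 step_at addn1.
by case: i ei => //= *; congr State; congruence.
Qed.

Lemma runs_seq c1 c2 m t1 m1 t2 m2 :
  runs c1 m t1 m1 -> runs c2 m1 t2 m2 -> runs (Seq c1 c2) m (t1 + t2) m2.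
Proof.
move=> r1 r2 P1 P2; rewrite run_add /=.
have := r1 P1 (compile (size P1 + len c1) c2 ++ P2).
rewrite -catA => ->.
have := r2 (P1 ++ compile (size P1) c1) P2.
by rewrite size_cat size_compile -!catA => ->; rewrite addnA.
Qed.

Lemma runs_if0 r c1 c2 m t m' :
  m r = 0 -> runs c1 m t m' -> runs (If r c1 c2) m t.+1 m'.
Proof.
move=> mr r1 P1 P2; rewrite -add1n run_add /=.
rewrite /= run1 step_at mr eqxx.
have := r1 (P1 ++ Jz r (size P1 + len c2).+2 :: compile (size P1).+1 c2
  ++ [:: Jmp (size P1 + len c2 + len c1).+2]) P2.
rewrite !size_cat /= size_cat /= size_compile -!catA /= -!catA /=.
have -> : size P1 + (len c2 + 1).+1 = (size P1 + len c2).+2 by lia.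
by move=> ->; congr State; lia.
Qed.

Lemma runs_if1 r c1 c2 m t m' :
  m r != 0 -> runs c2 m t m' -> runs (If r c1 c2) m t.+2 m'.
Proof.
move=> /negPf mr r1 P1 P2; rewrite -[t.+2]add1n run_add /=.
rewrite /= run1 step_at mr.
set J := Jmp _; set C1 := compile _ c1.
have := r1 (P1 ++ [:: Jz r (size P1 + len c2).+2]) (J :: C1 ++ P2).
rewrite size_cat /= addn1 -!catA /= -[t.+1]addn1 run_add => ->.
rewrite run1.
have := step_at (P1 ++ Jz r (size P1 + len c2).+2 :: compile (size P1).+1 c2)
  J (C1 ++ P2) m'.
rewrite size_cat /= size_compile -catA /= addnS -addSn => ->.
by rewrite /J; congr State; lia.
Qed.

Lemma runs_loop0 p r b m t m' :
  runs p m t m' -> m' r = 0 -> runs (Loop p r b) m (t + 1) m'.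
Proof.
move=> rp mr P1 P2; rewrite run_add /=.
set C := _ :: _; have := rp P1 (C ++ P2); rewrite -catA => ->.
have := step_at (P1 ++ compile (size P1) p) (Jz r (size P1 + len p + len b).+2)
   ((compile (size P1 + len p).+1 b ++ [:: Jmp (size P1)]) ++ P2) m'.
rewrite run1 /= size_cat size_compile -catA /= mr eqxx => ->.
by congr State; lia.
Qed.

Lemma runs_loopS p r b m t1 m1 t2 m2 t3 m3 :
  runs p m t1 m1 -> m1 r != 0 -> runs b m1 t2 m2 ->
  runs (Loop p r b) m2 t3 m3 ->
  runs (Loop p r b) m (t1 + (1 + (t2 + (1 + t3)))) m3.
Proof.
move=> rp mr rb rl P1 P2; rewrite run_add /=.
set L := (size P1 + len p + len b).+2.
set B := compile (size P1 + len p).+1 b.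
have := rp P1 ((Jz r L :: B ++ [:: Jmp (size P1)]) ++ P2).
rewrite -!catA => ->; rewrite run_add.
have := step_at (P1 ++ compile (size P1) p) (Jz r L)
  ((B ++ [:: Jmp (size P1)]) ++ P2) m1.
rewrite run1 /= size_cat size_compile -catA /= (negPf mr) => ->.
rewrite run_add.
have := rb (P1 ++ compile (size P1) p ++ [:: Jz r L]) (Jmp (size P1) :: P2).
rewrite !size_cat size_compile /= addn1 addnS -!catA /= -/B => ->.
rewrite run_add.
have := step_at (P1 ++ compile (size P1) p ++ Jz r L :: B) (Jmp (size P1)) P2 m2.
rewrite run1 /= !size_cat /= !size_compile -!catA /=.
have -> : size P1 + (len p + (len b).+1) = (size P1 + len p).+1 + len b by lia.
move=> ->.
by have := rl P1 P2; rewrite /= -/L -/B -!catA /= -!catA.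
Qed.

(* Worst-case cost when every loop body is executed at most [N.+1] times. *)
Fixpoint cost (N : nat) (c : com) : nat :=
  match c with
  | Ins _ => 1
  | Skip => 0
  | Seq c1 c2 => cost N c1 + cost N c2
  | If _ c1 c2 => (cost N c1 + cost N c2).+2
  | Loop p _ b => N.+2 * (cost N p + cost N b).+2
  end.

(** Total correctness with the running time hidden behind the static bound [cost N c], so that only
    [wp_loop] has to bound a number of rounds. *)
Definition wp (N : nat) (c : com) (Q : memory -> Prop) (m : memory) : Prop :=
  exists t m', [/\ t <= cost N c, runs c m t m' & Q m'].

Section WP.
Variable N : nat.

Lemma wp_mono c (Q Q' : memory -> Prop) m :
  wp N c Q m -> (forall m', Q m' -> Q' m') -> wp N c Q' m.
Proof. by move=> [t [m' [le_t rm Qm]]] QQ; exists t, m'; split=> //; apply: QQ. Qed.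

Lemma wp_skip (Q : memory -> Prop) m : Q m -> wp N Skip Q m.
Proof.
by move=> Qm; exists 0, m; split=> // P1 P2; rewrite /run /= addn0.
Qed.

Lemma wp_ins i m' (Q : memory -> Prop) m :
  effect i m = Some m' -> Q m' -> wp N (Ins i) Q m.
Proof. by move=> e Qm; exists 1, m'; split=> //; apply: runs_ins. Qed.

Lemma wp_seq c1 c2 (Q : memory -> Prop) m :
  wp N c1 (wp N c2 Q) m -> wp N (Seq c1 c2) Q m.
Proof.
move=> [t1 [m1 [l1 r1 [t2 [m2 [l2 r2 Qm]]]]]].
by exists (t1 + t2), m2; split=> //; [apply: leq_add | apply: runs_seq r1 r2].
Qed.

Lemma wp_if r c1 c2 (Q : memory -> Prop) m :
  (m r = 0 -> wp N c1 Q m) -> (m r != 0 -> wp N c2 Q m) -> wp N (If r c1 c2) Q m.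
Proof.
move=> w1 w2; case: (eqVneq (m r) 0) => mr.
  have [t [m' [le_t rm Qm]]] := w1 mr.
  by exists t.+1, m'; split=> //=; [lia | apply: runs_if0].
have [t [m' [le_t rm Qm]]] := w2 mr.
by exists t.+2, m'; split=> //=; [lia | apply: runs_if1].
Qed.

(** The body runs at most [K] times and the test [p] once more, whence the factor [N.+2] in [cost].
    Allowing [K = N.+1] serves the threshold search, which tries D = 0, ..., n + 1. *)
Lemma wp_loop p r b K (I : nat -> memory -> Prop) (Q : memory -> Prop) m :
  K <= N.+1 ->
  (forall i m, i <= K -> I i m ->
     wp N p (fun m1 => (m1 r = 0 -> Q m1) /\
                       (m1 r != 0 -> i < K /\ wp N b (I i.+1) m1)) m) ->
  I 0 m -> wp N (Loop p r b) Q m.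
Proof.
move=> leK H I0.
suff: forall k i m, i + k = K -> I i m ->
    exists t m', [/\ t <= k.+1 * (cost N p + cost N b).+2,
                     runs (Loop p r b) m t m' & Q m'].
  move=> /(_ K 0 m (add0n K) I0) [t [m' [le_t rm Qm]]].
  exists t, m'; split=> //; apply: leq_trans le_t _.
  by rewrite /= leq_mul2r; apply/orP; right; lia.
elim=> [|k IHk] i {I0} {}m Ei Im.
  have [|t1 [m1 [l1 r1 [q0 q1]]]] := H i m _ Im; first lia.
  case: (eqVneq (m1 r) 0) => mr; last by have [] := q1 mr; lia.
  by exists (t1 + 1), m1; split; [lia | apply: runs_loop0 | apply: q0].
have [|t1 [m1 [l1 r1 [q0 q1]]]] := H i m _ Im; first lia.
case: (eqVneq (m1 r) 0) => mr.
  by exists (t1 + 1), m1; split; [nia | apply: runs_loop0 | apply: q0].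
have [_ [t2 [m2 [l2 r2 I2]]]] := q1 mr.
have [|t3 [m3 [l3 r3 Qm]]] := IHk i.+1 m2 _ I2; first lia.
exists (t1 + (1 + (t2 + (1 + t3)))), m3; split=> //; first by rewrite mulSn; lia.
exact: runs_loopS r1 mr r2 r3.
Qed.

End WP.

Lemma run_halted P t s : halted P s -> run P t s = s.
Proof.
move=> hs; have st : step P s = s.
  move: hs; case: s => p m; rewrite /halted /step /=.
  by case: ifP => // lt_p; case: (nth _ _ _).
by elim: t => //= t; rewrite /run /= => ->.
Qed.

(** Running off the end of the program counts as halting and halted states are fixed points, so a
    shorter run can be padded to exactly [T] steps. *)
Lemma wp_run N c (Q : memory -> Prop) m T :
  wp N c Q m -> cost N c <= T ->
  exists m', run (compile 0 c) T (State 0 m) = State (len c) m' /\ Q m'.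
Proof.
move=> [t [m' [le_t rm Qm]]] le_T; exists m'; split=> //.
have := rm [::] [::]; rewrite /= cats0 add0n => rt.
rewrite -(subnKC (leq_trans le_t le_T)) run_add rt run_halted //.
by rewrite /halted /= size_compile ltnn.
Qed.

(** * The greedy tour *)

Section Greedy.
Variables (n : nat) (Z : rel nat).

Definition deg (v : nat) : nat := count (Z v) (iota 0 n).
Definition low (D v : nat) : bool := deg v < D.
Definition fresh (D : nat) (T : seq nat) (v : nat) : bool :=
  (v \notin T) && low D v.

Definition match_step (D u : nat) (T : seq nat) (v : nat) : seq nat :=
  if [&& fresh D T u, fresh D T v & Z u v] then rcons (rcons T u) v else T.

Definition match_row (D : nat) (T : seq nat) (u : nat) : seq nat :=
  foldl (match_step D u) T (iota 0 n).

Definition matching_phase (D : nat) : seq nat :=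
  foldl (match_row D) [::] (iota 0 n).

(* The path built around a high vertex [s]; [c] counts its neighbours so far. *)
Definition star_step (D s : nat) (Tc : seq nat * nat) (v : nat) :=
  let: (T, c) := Tc in
  if [&& c < 2, fresh D T v & Z s v] then
    (if c == 0 then rcons (rcons T v) s else rcons T v, c.+1)
  else (T, c).

Definition star (D s : nat) (T : seq nat) : seq nat * nat :=
  foldl (star_step D s) (T, 0) (iota 0 n).

(* The second component counts the missing neighbours of high vertices. *)
Definition star_row (D : nat) (Tf : seq nat * nat) (s : nat) :=
  if low D s then Tf else ((star D s Tf.1).1, Tf.2 + (2 - (star D s Tf.1).2)).

Definition star_phase (D : nat) : seq nat * nat :=
  foldl (star_row D) (matching_phase D, 0) (iota 0 n).

Definition fill_step (T : seq nat) (v : nat) : seq nat :=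
  if v \in T then T else rcons T v.

Definition tour (D : nat) : seq nat :=
  foldl fill_step (star_phase D).1 (iota 0 n).

Definition defect (D : nat) : nat := (star_phase D).2.

Fixpoint zeros_along (T : seq nat) : nat :=
  if T is x :: T' then (if T' is y :: _ then Z x y : nat else 0) + zeros_along T'
  else 0.

Lemma zeros_along_rcons T x :
  zeros_along (rcons T x) =
  zeros_along T + ((0 < size T) && Z (last 0 T) x).
Proof.
elim: T => [|y T IH] //=; case: T IH => [|z T] IH /=; first by rewrite ?addn0 ?add0n.
by move: IH => /= ->; rewrite !addnA.
Qed.

Fixpoint all_pairs (Q : seq nat) : bool :=
  match Q with
  | x :: y :: Q' => Z x y && all_pairs Q'
  | [::] => true
  | _ => false
  end.

(* A matching of zero edges, listed as [x1; y1; x2; y2; ...]. *)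
Definition pairing (Q : seq nat) : Prop :=
  [/\ uniq Q, all (fun v => v < n) Q & all_pairs Q].

Lemma all_pairs_rcons2 Q x y :
  all_pairs Q -> Z x y -> all_pairs (rcons (rcons Q x) y).
Proof.
move=> + Zxy; have [k] := ubnP (size Q); elim: k Q => // k IH [|a [|b Q]] //=.
  by rewrite Zxy.
by move=> sQ /andP[-> aQ]; apply: IH => //; lia.
Qed.

Hypotheses (Zirr : forall v, Z v v = false).

Lemma pairing_rcons2 Q x y :
  pairing Q -> x \notin Q -> y \notin Q -> Z x y -> x < n -> y < n ->
  pairing (rcons (rcons Q x) y).
Proof.
move=> [uQ bQ aQ] xQ yQ Zxy xn yn; split; last exact: all_pairs_rcons2.
  rewrite !rcons_uniq mem_rcons inE xQ uQ (negPf yQ) orbF /= andbT.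
  by apply/eqP => exy; rewrite exy Zirr in Zxy.
by rewrite !all_rcons xn yn.
Qed.

Lemma foldl_iota_ind (A : Type) (f : A -> nat -> A) (I : nat -> A -> Prop) x k :
  I 0 x -> (forall i y, i < k -> I i y -> I i.+1 (f y i)) ->
  I k (foldl f x (iota 0 k)).
Proof.
move=> I0 IS; suff H j : j <= k -> I j (foldl f x (iota 0 j)) by exact: H.
elim: j => // j IH lt_j; rewrite -addn1 iotaD foldl_cat /= add0n addn1.
by apply: IS => //; apply: IH; apply: ltnW.
Qed.

(** * Matching and star phases at a fixed threshold *)

Section Threshold.
Variable D : nat.

Definition matching_inv (T : seq nat) : Prop :=
  [/\ pairing T, all (low D) T & (zeros_along T).*2 >= size T].

Lemma match_step_inv u T v :
  u < n -> v < n -> matching_inv T -> matching_inv (match_step D u T v).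
Proof.
move=> un vn [pT lT zT]; rewrite /match_step.
case: ifP => // /and3P[/andP[uT lu] /andP[vT lv] Zuv]; split.
- exact: pairing_rcons2.
- by rewrite !all_rcons lu lv lT.
- rewrite zeros_along_rcons last_rcons !size_rcons Zuv /= zeros_along_rcons; lia.
Qed.

Lemma match_step_sub u T v : {subset T <= match_step D u T v}.
Proof.
move=> x xT; rewrite /match_step; case: ifP => // _.
by rewrite !(mem_rcons, inE) xT !orbT.
Qed.

Lemma match_row_inv u T :
  u < n -> matching_inv T -> matching_inv (match_row D T u).
Proof.
move=> un iT; apply: (foldl_iota_ind (I := fun _ T => matching_inv T)) => //.
by move=> v T' vn; apply: match_step_inv.
Qed.

Lemma match_row_sub u T : {subset T <= match_row D T u}.
Proof.
apply: (foldl_iota_ind (I := fun _ T' => {subset T <= T'})) => // v T' _ sT x xT.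
by apply: match_step_sub; apply: sT.
Qed.

Definition covers (T : seq nat) u v : Prop :=
  low D u -> low D v -> Z u v -> (u \in T) || (v \in T).

Lemma match_row_cover u T v : v < n -> covers (match_row D T u) u v.
Proof.
move: v; apply: (foldl_iota_ind
  (I := fun i T' => forall v, v < i -> covers T' u v)) => // i T' lt_i IH v.
rewrite ltnS leq_eqVlt => /orP[/eqP->|lt_v] lu lv Zuv.
  rewrite /match_step; case: ifP => [_|].
    by rewrite !(mem_rcons, inE) eqxx !orbT.
  rewrite /fresh lu lv Zuv !andbT => /negbT.
  by rewrite negb_and !negbK.
have /orP[uT|vT] := IH v lt_v lu lv Zuv.
  by rewrite (match_step_sub _ _ uT).
by rewrite (match_step_sub _ _ vT) orbT.
Qed.

Lemma matching_phase_inv : matching_inv (matching_phase D).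
Proof.
apply: (foldl_iota_ind (I := fun _ T => matching_inv T)) => //.
by move=> u T un; apply: match_row_inv.
Qed.

Lemma matching_phase_cover u v : u < n -> v < n -> covers (matching_phase D) u v.
Proof.
move: u v; apply: (foldl_iota_ind
  (I := fun i T' => forall u v, u < i -> v < n -> covers T' u v)) => //.
move=> i T _ IH u v; rewrite ltnS leq_eqVlt => /orP[/eqP->|lt_u] vn.
  exact: match_row_cover.
move=> lu lv Zuv; have /orP[uT|vT] := IH u v lt_u vn lu lv Zuv.
  by rewrite (match_row_sub _ uT).
by rewrite (match_row_sub _ vT) orbT.
Qed.

Definition high_below (i : nat) : nat := count (predC (low D)) (iota 0 i).

Lemma high_belowS i : high_below i.+1 = high_below i + ~~ low D i.
Proof. by rewrite /high_below -addn1 iotaD count_cat /= addn0. Qed.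

(** A high vertex enters the list only as the centre of its own star, so those present before round
    [i] are below [i]. Hence a centre is never inserted twice. *)
Definition tour_inv (i : nat) (T : seq nat) : Prop :=
  [/\ uniq T, all (fun v => v < n) T & forall x, x \in T -> low D x || (x < i)].

Lemma star_step_inv s T c v :
  s < n -> ~~ low D s -> v < n -> tour_inv (s + (0 < c)) T ->
  let Tc := star_step D s (T, c) v in tour_inv (s + (0 < Tc.2)) Tc.1.
Proof.
move=> sn hs vn [uT bT lT] /=; case: ifP => //= /and3P[c2 /andP[vT lv] Zsv].
have sv : (s == v) = false.
  by apply: contraNF hs => /eqP->.
case: eqP => [c0|/eqP c0].
  have sT : s \notin T.
    by apply/negP => /lT; rewrite (negPf hs) /= c0 /= addn0 ltnn.
  split.
  - by rewrite !rcons_uniq mem_rcons inE sv (negPf sT) vT uT.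
  - by rewrite !all_rcons sn vn bT.
  - move=> x; rewrite !(mem_rcons, inE) => /or3P[/eqP->|/eqP->|/lT].
    + by rewrite addn1 ltnS leqnn orbT.
    + by rewrite lv.
    + by case/orP=> [->//|]; rewrite c0 => lt_x; apply/orP; right; lia.
have c1 : (0 < c) = true by lia.
rewrite c1 in lT.
split; first by rewrite rcons_uniq vT uT.
  by rewrite all_rcons vn bT.
by move=> x; rewrite !(mem_rcons, inE) => /orP[/eqP->|/lT //]; rewrite lv.
Qed.

Lemma star_prefix_inv s T j :
  s < n -> ~~ low D s -> tour_inv s T -> j <= n ->
  let Tc := foldl (star_step D s) (T, 0) (iota 0 j) in
  tour_inv (s + (0 < Tc.2)) Tc.1.
Proof.
move=> sn hs iT jn /=; apply: (foldl_iota_ind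
  (I := fun _ Tc => tour_inv (s + (0 < Tc.2)) Tc.1)); first by rewrite ?addn0 ?add0n.
by move=> v [T' c] vj; apply: star_step_inv => //; lia.
Qed.

Lemma tour_invW i j T : i <= j -> tour_inv i T -> tour_inv j T.
Proof.
move=> ij [uT bT lT]; split=> // x /lT /orP[->//|lt_x].
by rewrite (leq_trans lt_x ij) orbT.
Qed.

Lemma star_row_inv i Tf : i < n -> tour_inv i Tf.1 -> tour_inv i.+1 (star_row D Tf i).1.
Proof.
move=> lt_i iT; rewrite /star_row; case: ifPn => [_|hi] /=.
  by apply: tour_invW iT; apply: leqnSn.
apply: tour_invW (star_prefix_inv lt_i hi iT (leqnn n)).
by case: (0 < _); lia.
Qed.

Lemma matching_phase_tour_inv : tour_inv 0 (matching_phase D).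
Proof.
have [[uT bT _] lT _] := matching_phase_inv.
by split=> // x xT; rewrite (allP lT x xT).
Qed.

Lemma star_phase_prefix_inv j : j <= n ->
  tour_inv j (foldl (star_row D) (matching_phase D, 0) (iota 0 j)).1.
Proof.
move=> jn; apply: (foldl_iota_ind (I := fun i Tf => tour_inv i Tf.1)).
  exact: matching_phase_tour_inv.
by move=> i Tf ij; apply: star_row_inv; lia.
Qed.

(* [Q] is the ghost matching that pairs each centre with its first neighbour. *)
Definition star_inv (s : nat) (T0 Q0 : seq nat) (Tc : seq nat * nat) : Prop :=
  let: (T, c) := Tc in
  [/\ c <= 2, (0 < c -> s \in T) , zeros_along T >= zeros_along T0 + c,
      (c = 1 -> last 0 T = s) &
  exists Q, [/\ pairing Q, {subset Q <= T}, size Q = size Q0 + (0 < c).*2 &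
                (size T).*2 + (c == 1).*2 <= 3 * size Q]].

(** A matching edge adds two vertices to both the tour and the ghost matching, a full star three and
    two; hence the ratio 3/2. The term [(c == 1).*2] saves room for the second neighbour, which
    enlarges the tour alone. *)
Lemma star_spec s T0 Q0 :
  (forall u v, Z u v = Z v u) ->
  s < n -> ~~ low D s -> tour_inv s T0 -> pairing Q0 -> {subset Q0 <= T0} ->
  (size T0).*2 <= 3 * size Q0 ->
  star_inv s T0 Q0 (star D s T0).
Proof.
move=> Zsym sn hs iT pQ sQ leQ.
(* [tour_inv] is carried along because the first neighbour also inserts [s], which must be absent
   until then. *)
suff: tour_inv (s + (0 < (star D s T0).2)) (star D s T0).1 /\
      star_inv s T0 Q0 (star D s T0) by case.
apply: (foldl_iota_ind (I := fun _ Tc => tour_inv (s + (0 < Tc.2)) Tc.1 /\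
   star_inv s T0 Q0 Tc)).
  rewrite /= addn0; split=> //; split; rewrite ?addn0 //.
  by exists Q0; split=> //=; lia.
move=> v [T c] vn [/= iTc [c2 sT zT lT [Q [pQ' sQ' szQ leQ']]]].
have iTc' := star_step_inv sn hs vn iTc.
split=> //; move: iTc'; rewrite /star_step.
case: ifP => [/and3P[lt_c /andP[vT lv] Zsv] _|_ _]; last first.
  by split=> //; exists Q.
have sv : (s == v) = false by apply: contraNF hs => /eqP->.
case: eqP => [c0|/eqP c0].
  subst c; have sT0 : s \notin T.
    by case: iTc => _ _ /= lT'; apply/negP => /lT'; rewrite (negPf hs) addn0 ltnn.
  split=> //.
  - by rewrite mem_rcons inE eqxx.
  - rewrite zeros_along_rcons last_rcons size_rcons /= Zsym Zsv zeros_along_rcons; lia.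
  - by rewrite last_rcons.
  - exists (rcons (rcons Q v) s); split.
    + apply: pairing_rcons2 => //; last by rewrite Zsym.
      * by apply: contra vT => /sQ'.
      * by apply: contra sT0 => /sQ'.
    + move=> x; rewrite !(mem_rcons, inE) => /or3P[->|->|/sQ' ->]; rewrite ?orbT //.
    + by rewrite !size_rcons szQ /=; lia.
    + by rewrite !size_rcons /=; move: leQ' => /=; lia.
have c1 : c = 1 by lia.
subst c; split=> //.
- by rewrite mem_rcons inE sT ?orbT.
- rewrite zeros_along_rcons lT // Zsv andbT.
  have -> : 0 < size T by have := sT isT; case: (T).
  by lia.
- exists Q; split=> //.
  + by move=> x /sQ' xT; rewrite mem_rcons inE xT orbT.
  + by rewrite size_rcons /=; move: leQ' => /=; lia.
Qed.

Lemma star_step_sub s Tc v : {subset Tc.1 <= (star_step D s Tc v).1}.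
Proof.
case: Tc => T c x xT; rewrite /star_step; case: ifP => // _ /=.
by case: ifP => _; rewrite !(mem_rcons, inE) xT !orbT.
Qed.

Lemma star_step_count s Tc v : Tc.2 <= (star_step D s Tc v).2.
Proof. by case: Tc => T c; rewrite /star_step; case: ifP. Qed.

(** The count never decreases, so it was below 2 when [v] was scanned; [v] was then either present
    already or appended. *)
Lemma star_full s T v :
  (star D s T).2 < 2 -> v < n -> low D v -> Z s v -> v \in (star D s T).1.
Proof.
move=> + + lv Zsv; move: v lv Zsv.
suff H : forall v, low D v -> Z s v -> (star D s T).2 < 2 -> v < n ->
   v \in (star D s T).1 by move=> v lv Zv c2 vn; apply: H.
move=> v lv Zsv; apply: (foldl_iota_ind
  (I := fun i Tc => Tc.2 < 2 -> v < i -> v \in Tc.1)) => // i [T' c] lt_i IH.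
move=> c2; have c2' : c < 2.
  by apply: leq_ltn_trans c2; apply: (star_step_count s (T', c)).
rewrite ltnS leq_eqVlt => /orP[/eqP Ev|lt_v]; last first.
  by apply: star_step_sub; apply: IH.
rewrite -Ev /star_step c2' /fresh lv Zsv !andbT.
case: ifPn => [_|]; last by rewrite negbK.
by case: ifP => _; rewrite !(mem_rcons, inE) eqxx ?orbT.
Qed.

End Threshold.

Definition low_cover (D : nat) (Q : seq nat) : Prop :=
  forall u v, u < n -> v < n -> covers D Q u v.

Lemma exists_maximal_pairing :
  exists2 Q, pairing Q & forall u v, u < n -> v < n -> Z u v ->
    (u \in Q) || (v \in Q).
Proof.
(* At threshold n + 1 every vertex is low, so the greedy matching is maximal in the whole zero
   graph. *)
have [pQ _ _] := matching_phase_inv n.+1.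
exists (matching_phase n.+1) => // u v un vn.
have lown x : low n.+1 x.
  by rewrite /low ltnS /deg -[X in _ <= X](size_iota 0 n) count_size.
exact: (matching_phase_cover un vn (lown u) (lown v)).
Qed.

Lemma count_mem_le (P : pred nat) (T : seq nat) :
  (forall v, v < n -> P v -> v \in T) -> count P (iota 0 n) <= size T.
Proof.
move=> PT; rewrite -size_filter; apply: uniq_leq_size.
  by rewrite filter_uniq ?iota_uniq.
by move=> x; rewrite mem_filter mem_iota add0n => /and3P[Px _ xn]; apply: PT.
Qed.

(** If a maximal matching misses a high vertex, it contains all the zero-neighbours of that vertex,
    at least [D] of them; otherwise it contains every high vertex. *)
Lemma exists_pairing_high D :
  exists2 Q, pairing Q & D <= size Q \/ high_below D n <= size Q.
Proof.
have [Q pQ mQ] := exists_maximal_pairing; exists Q => //.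
case: (leqP D (size Q)) => [|ltD]; [by left | right].
apply: count_mem_le => v vn /= hv; apply/negPn/negP => vQ.
move: hv; rewrite /low => /negP[]; apply: leq_ltn_trans ltD.
apply: count_mem_le => u un Zvu.
by have /orP[/(negP vQ)|] := mQ v u vn un Zvu.
Qed.

Hypothesis Zsym : forall u v, Z u v = Z v u.

(** After a failure every zero-neighbour of [s] is high or already in the tour. The tour is bounded
    by 3/2 of [size Q], the number of high vertices by a second matching. *)
Lemma star_failure D s T Q :
  ~~ low D s -> (star D s T).2 < 2 -> pairing Q ->
  (size (star D s T).1).*2 <= 3 * size Q ->
  exists Q1 Q2, [/\ pairing Q1, pairing Q2 & D.*2 <= 3 * size Q1 + 2 * size Q2].
Proof.
move=> hs c2 pQ leQ; have [Q2 pQ2 h2] := exists_pairing_high D.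
exists Q, Q2; split=> //; case: h2 => h2; first by lia.
have: deg s <= size ((star D s T).1 ++ filter (predC (low D)) (iota 0 n)).
  apply: count_mem_le => v vn Zsv; rewrite mem_cat mem_filter mem_iota add0n vn /=.
  case: (boolP (low D v)) => lv; last by rewrite orbT.
  by rewrite star_full.
rewrite size_cat size_filter -/(high_below D n).
by move: hs; rewrite /low; lia.
Qed.

(** As long as nothing is missing, the sizes are tracked; from the first failure on, what matters is
    the pair of matchings found at that moment. *)
Definition phase_inv (D i : nat) (Tf : seq nat * nat) : Prop :=
  let: (T, f) := Tf in let T1 := matching_phase D in
  exists Q, [/\ pairing Q, {subset Q <= T}, (size T).*2 <= 3 * size Q,
    f = 0 -> size Q = size T1 + (high_below D i).*2 /\
             size T1 + 4 * high_below D i <= (zeros_along T).*2 &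
    f <> 0 -> exists Q1 Q2,
      [/\ pairing Q1, pairing Q2 & D.*2 <= 3 * size Q1 + 2 * size Q2]].

Lemma star_phase_inv D : phase_inv D n (star_phase D).
Proof.
suff: tour_inv D n (star_phase D).1 /\ phase_inv D n (star_phase D) by case.
have [pT lT zT] := matching_phase_inv D.
apply: (foldl_iota_ind (I := fun i Tf => tour_inv D i Tf.1 /\ phase_inv D i Tf)).
  split; first exact: matching_phase_tour_inv.
  exists (matching_phase D); split=> //; first by lia.
  by move=> _; rewrite /high_below /=; lia.
move=> i [T f] lt_i [iT [Q [pQ sQ leQ f0 f1]]].
split; first exact: star_row_inv.
rewrite /star_row; case: ifPn => li.
  by exists Q; split=> //; rewrite high_belowS li addn0.
have := star_spec Zsym lt_i li iT pQ sQ leQ => /=.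
have fl := @star_failure D i T _ li.
case: (star D i T) fl => T' c /= fl [c2 _ zT' _ [Q' [pQ' sQ' szQ' leQ']]].
exists Q'; split=> //; first by lia.
- move=> fc; have [Ef Ec] : f = 0 /\ c = 2 by lia.
  subst c; have [e1 e2] := f0 Ef.
  by rewrite high_belowS li szQ' /= e1; lia.
- case: (eqVneq f 0) => [f00|/eqP fn0 _]; last exact: f1.
  by move=> fc; apply: (fl Q') => //; lia.
Qed.

Lemma fill_prefix T j :
  uniq T -> all (fun v => v < n) T -> j <= n ->
  let T' := foldl fill_step T (iota 0 j) in
  [/\ uniq T', all (fun v => v < n) T', zeros_along T <= zeros_along T' &
      forall v, v < j -> v \in T'].
Proof.
move=> uT bT jn /=; apply: (foldl_iota_ind (I := fun i T' =>
  [/\ uniq T', all (fun v => v < n) T', zeros_along T <= zeros_along T' &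
      forall v, v < i -> v \in T'])) => //.
move=> i T' lt_i [uT' bT' zT' mT']; rewrite /fill_step; case: ifPn => iT'.
  by split=> // v; rewrite ltnS leq_eqVlt => /orP[/eqP->|/mT'].
split; first by rewrite rcons_uniq iT' uT'.
- by rewrite all_rcons bT' andbT; lia.
- by rewrite zeros_along_rcons; lia.
- by move=> v; rewrite ltnS leq_eqVlt mem_rcons inE => /orP[->|/mT' ->]; rewrite ?orbT.
Qed.

Lemma star_phase_uniq D :
  uniq (star_phase D).1 /\ all (fun v => v < n) (star_phase D).1.
Proof. by have [] := star_phase_prefix_inv D (leqnn n). Qed.

Lemma tour_perm D : perm_eq (tour D) (iota 0 n).
Proof.
have [uT bT] := star_phase_uniq D.
have [uT' bT' _ mT'] := fill_prefix uT bT (leqnn n).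
apply: uniq_perm => //; first exact: iota_uniq.
move=> v; rewrite mem_iota add0n /=; apply/idP/idP => [/(allP bT') //|].
exact: mT'.
Qed.

Lemma tour_success D : defect D = 0 ->
  [/\ pairing (matching_phase D), low_cover D (matching_phase D),
      exists2 Q, pairing Q &
        size Q = size (matching_phase D) + (high_below D n).*2 &
      size (matching_phase D) + 4 * high_below D n <= (zeros_along (tour D)).*2].
Proof.
rewrite /defect => f0.
have [pT1 _ _] := matching_phase_inv D.
have [uT bT] := star_phase_uniq D.
have [_ _ zT' _] := fill_prefix uT bT (leqnn n).
have := star_phase_inv D; case E: (star_phase D) f0 zT' => [T f] /= f0 zT'.
move=> [Q [pQ _ _ /(_ f0) [szQ leZ] _]].
split=> //; first by move=> u v; apply: matching_phase_cover.
  by exists Q.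
by apply: leq_trans leZ _; rewrite leq_double /tour E.
Qed.

Lemma tour_failure D : defect D <> 0 ->
  exists Q1 Q2, [/\ pairing Q1, pairing Q2 & D.*2 <= 3 * size Q1 + 2 * size Q2].
Proof.
rewrite /defect; have := star_phase_inv D; case: (star_phase D) => T f /=.
by case=> Q [_ _ _ _ H] /H.
Qed.

(** No vertex is high at this threshold, so the search for D terminates. *)
Lemma defect_large : defect n.+1 = 0.
Proof.
rewrite /defect /star_phase.
apply: (foldl_iota_ind (I := fun _ (Tf : seq nat * nat) => Tf.2 = 0)) => //.
move=> i Tf _; rewrite /star_row.
by rewrite /low ltnS /deg -[X in _ <= X](size_iota 0 n) count_size.
Qed.

End Greedy.

(** * The RAM program *)

Lemma upd_same m a v : upd m a v a = v.
Proof. by rewrite /upd eqxx. Qed.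

Lemma upd_ne m a v x : x != a -> upd m a v x = m x.
Proof. by rewrite /upd => /negPf->. Qed.

Fixpoint block (cs : seq com) : com :=
  if cs is c :: cs' then Seq c (block cs') else Skip.

Definition For (r : nat) (b : com) : com :=
  Seq (Ins (Const r 0))
      (Loop (Ins (Defs.Sub 14 0 r)) 14 (Seq b (Ins (Add r r 1)))).

(* Registers: 0 = n, 1 = the constant 1, 2, 3, 4 = base addresses of the
   tour, of the marks and of the degrees, 5 = D, 6 = length of the tour,
   7 = defect, 8, 9 = current vertices, 15 = neighbours found so far,
   10-14 and 16 = scratch.  For n >= 16 the cells 1-16 initially hold part of
   row 0 of the weight matrix, which by symmetry is never needed.  For n < 16
   the program outputs the identity: a dense instance then has no zero edge. *)

Definition scratch : seq nat := [:: 10; 11; 12; 13; 14; 16].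
Definition volatile : seq nat := [:: 7, 8, 9, 15 & scratch].

(** The machine cannot multiply, so the address 1 + max * n + min is built by repeated addition.
    Register 13 ends up as 1 exactly when both vertices coincide, which makes the result nonzero on
    the diagonal. *)
Definition readz : com := block
  [:: Ins (Defs.Sub 13 8 9); Ins (Add 12 13 9); Ins (Add 11 8 9);
      Ins (Defs.Sub 11 11 12); Ins (Add 11 11 1); Ins (Defs.Sub 10 9 8);
      Ins (Add 13 13 10); Ins (Defs.Sub 13 1 13);
      Loop Skip 12 (Seq (Ins (Add 11 11 0)) (Ins (Defs.Sub 12 12 1)));
      Ins (LoadI 10 11); Ins (Add 10 10 13)].

(** Subtraction is truncated, so degree + 1 - D vanishes exactly when the degree is below D.
    Register 16 adds up failed tests and stays zero when all succeed. *)
Definition chk (x : nat) : com := block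
  [:: Ins (Add 11 3 x); Ins (LoadI 10 11); Ins (Add 16 16 10);
      Ins (Add 11 4 x); Ins (LoadI 10 11); Ins (Add 10 10 1);
      Ins (Defs.Sub 10 10 5); Ins (Add 16 16 10)].

Definition push (x : nat) : com := block
  [:: Ins (Add 11 2 6); Ins (StoreI 11 x); Ins (Add 11 3 x);
      Ins (StoreI 11 1); Ins (Add 6 6 1)].

Definition match_code : com := block
  [:: Ins (Const 16 0); chk 8; chk 9; readz; Ins (Add 16 16 10);
      If 16 (Seq (push 8) (push 9)) Skip].

Definition star_code : com := block
  [:: Ins (Const 16 0); chk 9; readz; Ins (Add 16 16 10);
      Ins (Defs.Sub 10 15 1); Ins (Add 16 16 10);
      If 16 (block [:: push 9; If 15 (push 8) Skip; Ins (Add 15 15 1)]) Skip].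

Definition star_row_code : com := block
  [:: Ins (Add 11 4 8); Ins (LoadI 10 11); Ins (Defs.Sub 10 5 10);
      If 10 (block [:: Ins (Const 15 0); For 9 star_code; Ins (Const 10 2);
                       Ins (Defs.Sub 10 10 15); Ins (Add 7 7 10)]) Skip].

Definition fill_code : com := block
  [:: Ins (Add 11 3 8); Ins (LoadI 10 11); If 10 (push 8) Skip].

Definition reset_code : com := block
  [:: Ins (Add 11 3 8); Ins (Const 10 0); Ins (StoreI 11 10)].

Definition attempt : com := block
  [:: Ins (Const 6 0); Ins (Const 7 0); For 8 reset_code;
      For 8 (For 9 match_code); For 8 star_row_code; For 8 fill_code].

Definition deg_code : com := block
  [:: readz; If 10 (block [:: Ins (Add 11 4 8); Ins (LoadI 10 11);
                              Ins (Add 10 10 1); Ins (StoreI 11 10)]) Skip].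

Definition main_code : com := block
  [:: Ins (Add 3 2 0); Ins (Add 4 3 0); For 8 (For 9 deg_code);
      Ins (Const 5 0); Loop attempt 7 (Ins (Add 5 5 1))].

Definition small_code : com :=
  For 8 (block [:: Ins (Add 10 2 8); Ins (StoreI 10 8)]).

Definition tsp_code : com := block
  [:: Ins (Const 1 1); Ins (Const 11 1); For 8 (Ins (Add 11 11 0));
      Ins (Const 10 0); Ins (Add 2 11 10); Ins (Const 10 16);
      Ins (Defs.Sub 10 10 0); If 10 main_code small_code].

Definition agree (L : seq nat) (m m' : memory) : Prop :=
  forall x, x \notin L -> m' x = m x.

Lemma agree_trans L m1 m2 m3 : agree L m1 m2 -> agree L m2 m3 -> agree L m1 m3.
Proof. by move=> h1 h2 x xL; rewrite h2 // h1. Qed.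

Lemma agree_upd L m m' r v : r \in L -> agree L m m' -> agree L m (upd m' r v).
Proof.
move=> rL h x xL; rewrite upd_ne ?h //.
by apply: contraNneq xL => ->.
Qed.

Lemma agree_volatile m m' : agree scratch m m' -> agree volatile m m'.
Proof.
by move=> h x; rewrite /volatile !inE !negb_or => /and5P[_ _ _ _ ?]; apply: h;
  rewrite /scratch !inE !negb_or.
Qed.

Ltac upds := repeat first [rewrite upd_same | rewrite upd_ne; last by first [done | lia]].
Ltac ins := apply: wp_seq; eapply wp_ins; [reflexivity |]; upds.

Lemma foldl_iotaS (A : Type) (f : A -> nat -> A) x i :
  foldl f x (iota 0 i.+1) = f (foldl f x (iota 0 i)) i.
Proof. by rewrite -addn1 iotaD foldl_cat. Qed.

Section Refine.
Variables (n : nat) (w : instance n).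

(** [enc_weight] is false outside the vertex range, so [zadj] holds there for distinct arguments;
    the scans stay within [iota 0 n]. *)
Definition zadj (u v : nat) : bool := (u != v) && ~~ enc_weight w u v.

Lemma enc_weight_sym u v : enc_weight w u v = enc_weight w v u.
Proof.
apply/idP/idP => /existsP[x /existsP[y /and4P[xu yv xy wxy]]];
  apply/existsP; exists y; apply/existsP; exists x;
  by rewrite xu yv eq_sym xy setUC wxy.
Qed.

Lemma zadj_sym u v : zadj u v = zadj v u.
Proof. by rewrite /zadj eq_sym enc_weight_sym. Qed.

Lemma zadj_irr v : zadj v v = false.
Proof. by rewrite /zadj eqxx. Qed.

Notation dg := (deg n zadj).

(** [J] must be blind to the counter [r] and to register 14, which the loop control overwrites; the
    body learns the counter from [m r = i]. *)
Lemma wp_for r b (J : nat -> memory -> Prop) (Q : memory -> Prop) m :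
  r \notin [:: 0; 1; 14] ->
  (forall i m, J i m -> m 0 = n /\ m 1 = 1) ->
  (forall i m m', agree [:: r; 14] m m' -> J i m -> J i m') ->
  J 0 m ->
  (forall i m, i < n -> J i m -> m r = i ->
     wp n b (fun m' => J i.+1 m' /\ m' r = i) m) ->
  (forall m, J n m -> Q m) ->
  wp n (For r b) Q m.
Proof.
rewrite !inE !negb_or => /and3P[r0 r1 r14] J01 Jst J0 Jb JQ.
apply: wp_seq; eapply wp_ins; first by [].
apply: (@wp_loop n _ _ _ n (fun i m => J i m /\ m r = i)) => //; last first.
  split; last by rewrite upd_same.
  by apply: Jst J0; apply: agree_upd; rewrite ?inE ?eqxx.
move=> i {J0}m lei [Ji mr]; have [m0 m1] := J01 _ _ Ji.
eapply wp_ins; first by [].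
have ag : agree [:: r; 14] m (upd m 14 (m 0 - m r)).
  by apply: agree_upd; rewrite ?inE ?eqxx ?orbT.
rewrite m0 mr in ag *; have Ji' := Jst _ _ _ ag Ji.
rewrite upd_same; split=> [i0|ni].
  by apply: JQ; have Ei : i = n by [lia]; rewrite {1}Ei in Ji'.
have lt_i : i < n by lia.
split=> //; apply: wp_seq; apply: (wp_mono (Jb i _ lt_i _ _)).
- exact: Ji'.
- by rewrite upd_ne.
move=> m' [Ji1 mr']; eapply wp_ins; first by [].
have [_ m1'] := J01 _ _ Ji1.
split; last by rewrite upd_same mr' m1' addn1.
by apply: Jst Ji1; apply: agree_upd; rewrite ?inE ?eqxx.
Qed.

Hypothesis n16 : 16 <= n.

Definition Base (m : memory) : Prop :=
  [/\ m 0 = n, m 1 = 1 & forall a, n < a <= n * n -> m a = init_mem w a].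

Definition Tables (m : memory) : Prop :=
  [/\ m 2 = n * n + 1, m 3 = n * n + 1 + n, m 4 = n * n + 1 + n + n &
      forall v, v < n -> m (n * n + 1 + n + n + v) = dg v].

Definition Tour (D : nat) (T : seq nat) (m : memory) : Prop :=
  [/\ m 5 = D, m 6 = size T,
      forall i, i < size T -> m (n * n + 1 + i) = nth 0 T i &
      forall v, v < n -> m (n * n + 1 + n + v) = (v \in T)].

Definition Inv (D : nat) (T : seq nat) (m : memory) : Prop :=
  [/\ Base m, Tables m, Tour D T m, uniq T & all (fun v => v < n) T].

Lemma volatile_lt x : 16 < x -> x \notin volatile.
Proof. by move=> xn; rewrite /volatile /scratch !inE; lia. Qed.

Lemma scratch_lt x : 16 < x -> x \notin scratch.
Proof. by move=> xn; rewrite /scratch !inE; lia. Qed.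

Lemma Base_agree m m' : agree volatile m m' -> Base m -> Base m'.
Proof.
move=> ag [h0 h1 h]; split; rewrite ?ag // => a ha; rewrite ag ?h //.
by apply: volatile_lt; lia.
Qed.

Lemma Tables_agree m m' : agree volatile m m' -> Tables m -> Tables m'.
Proof.
move=> ag [h2 h3 h4 h]; split; rewrite ?ag // => v hv; rewrite ag ?h //.
by apply: volatile_lt; lia.
Qed.

Lemma Tour_agree D T m m' : agree volatile m m' -> Tour D T m -> Tour D T m'.
Proof.
move=> ag [h5 h6 h7 h8]; split; rewrite ?ag // => v hv; rewrite ag ?h7 ?h8 //;
  by apply: volatile_lt; lia.
Qed.

Lemma Inv_agree D T m m' : agree volatile m m' -> Inv D T m -> Inv D T m'.
Proof.
move=> ag [hB hT hR u a]; split=> //.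
- exact: Base_agree hB.
- exact: Tables_agree hT.
- exact: Tour_agree hR.
Qed.

Lemma wp_readz m :
  Base m -> m 8 < n -> m 9 < n ->
  wp n readz (fun m' => agree scratch m m' /\
                        ((m' 10 == 0) = zadj (m 8) (m 9)) /\ m' 16 = m 16) m.
Proof.
move=> [m0 m1 mi]; set u := m 8; set v := m 9 => un vn.
rewrite /readz /=; do 8 ins.
set mx := u - v + v; set mn := u + v - mx.
set df := 1 - (u - v + (v - u)).
apply: wp_seq.
apply: (@wp_loop n _ _ _ mx (fun i m' => [/\ agree scratch m m', m' 16 = m 16,
  m' 12 = mx - i, m' 11 = mn + 1 + i * n & m' 13 = df])).
- by rewrite /mx; lia.
- move=> i m1' lei [ag a16 a12 a11 a13]; apply: wp_skip; split; last first.
    move=> h12; have lti : i < mx by lia.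
    split=> //; ins; eapply wp_ins; first by [].
    upds; split; upds => //.
    + by do 2![apply: agree_upd => //].
    + by rewrite a12 ag // m1; lia.
    + by rewrite a11 ag // m0 mulSn; lia.
  move=> h12; have {lei} Ei : i = mx by lia.
  subst i; ins; ins; apply: wp_skip; split; [|split]; upds => //.
    by do 2![apply: agree_upd => //].
  rewrite a13 a11 addn_eq0 /zadj andbC.
  case: (eqVneq u v) => [uv|uv].
    have -> : df = 1 by rewrite /df; lia.
    by [].
  have -> : df = 0 by rewrite /df; move/eqP: uv; lia.
  have mxp : 0 < mx < n by rewrite /mx; move/eqP: uv; lia.
  have mnp : mn < mx by rewrite /mn /mx; move/eqP: uv; lia.
  (* Since [mx] is positive, the cell lies beyond row 0 and hence beyond the registers. *)
  rewrite ag; last by apply: scratch_lt; nia.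
  rewrite mi; last by nia.
  rewrite /init_mem ifN; last by lia.
  rewrite ifT; last by nia.
  have -> : mn + 1 + mx * n - 1 = mx * n + mn by lia.
  rewrite divnMDl ?divn_small ?modnMDl ?modn_small ?addn0; try lia.
  rewrite eqb0 /= ?andbT.
  suff -> : enc_weight w mx mn = enc_weight w u v by [].
  case: (leqP u v) => uv'.
    have -> : mx = v by rewrite /mx; lia.
    have -> : mn = u by rewrite /mn /mx; lia.
    exact: enc_weight_sym.
  have -> : mx = u by rewrite /mx; lia.
  by have -> : mn = v by rewrite /mn /mx; lia.
- split; upds; rewrite ?m1 ?mul0n ?addn0 //.
    by do 8![apply: agree_upd => //].
  by rewrite subn0.
Qed.

Lemma wp_chk D (T : seq nat) (x : nat) m :
  x \in [:: 8; 9] -> Inv D T m -> m x < n ->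
  wp n (chk x) (fun m' => agree scratch m m' /\
    ((m' 16 == 0) = (m 16 == 0) && fresh n zadj D T (m x))) m.
Proof.
move=> hx [[_ h1 _] [_ h3 h4 hd] [h5 _ _ hu] _ _] xn.
have [x16 x10 x11] : [/\ x != 16, x != 10 & x != 11].
  by move: hx; rewrite !inE => /orP[] /eqP->.
have hb : 16 < n * n by nia.
rewrite /chk /=; ins.
ins; rewrite h3 hu //.
ins; ins.
ins; rewrite h4 hd //.
ins; ins; ins; apply: wp_skip; split.
  by do 8![apply: agree_upd => //].
upds; rewrite /fresh /low !addn_eq0 eqb0 h5 h1 -andbA; congr [&& _, _ & _].
by rewrite subn_eq0 addn1.
Qed.

Lemma size_tour_lt (T : seq nat) (x : nat) :
  uniq T -> all (fun v => v < n) T -> x < n -> x \notin T -> size T < n.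
Proof.
move=> uT aT xn xT; rewrite -(size_rcons T x) -[X in _ <= X](size_iota 0 n).
apply: uniq_leq_size; first by rewrite rcons_uniq xT uT.
move=> y; rewrite !(mem_rcons, inE) mem_iota add0n /=.
by case/orP=> [/eqP->//|/(allP aT)].
Qed.

Lemma wp_push D (T : seq nat) (x : nat) m :
  x \in [:: 8; 9] -> Inv D T m -> m x < n -> m x \notin T ->
  wp n (push x) (fun m' => Inv D (rcons T (m x)) m' /\
    forall r, r \in [:: 7; 8; 9; 15] -> m' r = m r) m.
Proof.
move=> hx [[h0 h1 hi] [h2 h3 h4 hd] [h5 h6 h7 hu] uT aT] xn xT.
have [x6 x11 xlt] : [/\ x != 6, x != 11 & x < 16].
  by move: hx; rewrite !inE => /orP[] /eqP->.
have hb : 16 < n * n by nia.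
(* The new entry fits into the [n] cells of the tour and does not run into the marks. *)
have lt_s := size_tour_lt uT aT xn xT.
rewrite /push /=; do 5 ins.
rewrite h1 h2 h3 h6; apply: wp_skip; split; last first.
  by move=> r; rewrite !inE => /or4P[] /eqP->; upds.
split; last 2 first.
- by rewrite rcons_uniq xT uT.
- by rewrite all_rcons xn aT.
- split; upds => //; move=> a ha; rewrite -hi //; upds => //.
- split; upds => //; move=> v hv; upds; exact: hd.
split; upds => //; first by rewrite size_rcons addn1.
  move=> i; rewrite size_rcons ltnS leq_eqVlt nth_rcons => /orP[/eqP->|lt_i].
    by upds; rewrite ltnn eqxx.
  by rewrite lt_i; upds; apply: h7.
move=> v vn; rewrite !(mem_rcons, inE).
case: (eqVneq v (m x)) => [->|vx]; first by upds.
by move/eqP: vx => vx; upds; rewrite hu.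
Qed.

Definition keep (m m' : memory) : Prop :=
  forall r, r \in [:: 7; 8; 9; 15] -> m' r = m r.

Lemma agree_keep m m' : agree scratch m m' -> keep m m'.
Proof.
by move=> ag r; rewrite !inE => /or4P[] /eqP->; rewrite ag.
Qed.

Lemma keep_trans m1 m2 m3 : keep m1 m2 -> keep m2 m3 -> keep m1 m3.
Proof. by move=> h1 h2 r hr; rewrite h2 // h1. Qed.

Lemma agree_scratch_upd m r v : r \in scratch -> agree scratch m (upd m r v).
Proof. by move=> hr; apply: agree_upd. Qed.

Lemma wp_match_code D T m u v :
  Inv D T m -> m 8 = u -> m 9 = v -> u < n -> v < n ->
  wp n match_code (fun m' =>
    Inv D (match_step n zadj D u T v) m' /\ keep m m') m.
Proof.
move=> iT m8 m9 un vn; rewrite /match_code /=; ins.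
set m1 := upd m 16 0.
have ag1 : agree scratch m m1 by apply: agree_scratch_upd.
have i1 := Inv_agree (agree_volatile ag1) iT.
have m1_8 : m1 8 = u by rewrite ag1.
have m1_9 : m1 9 = v by rewrite ag1.
apply: wp_seq; apply: (wp_mono (wp_chk (x := 8) _ i1 _)); rewrite ?m1_8 //.
move=> m2 [ag2 e2].
have ag12 := agree_trans ag1 ag2.
have i2 := Inv_agree (agree_volatile ag2) i1.
have m2_8 : m2 8 = u by rewrite ag12.
have m2_9 : m2 9 = v by rewrite ag12.
apply: wp_seq; apply: (wp_mono (wp_chk (x := 9) _ i2 _)); rewrite ?m2_9 //.
move=> m3 [ag3 e3].
have ag13 := agree_trans ag12 ag3.
have i3 := Inv_agree (agree_volatile ag3) i2.
have m3_8 : m3 8 = u by rewrite ag13.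
have m3_9 : m3 9 = v by rewrite ag13.
have [B3 _ _ _ _] := i3.
apply: wp_seq; apply: (wp_mono (wp_readz B3 _ _)); rewrite ?m3_8 ?m3_9 //.
move=> m4 [ag4 [e4 e4']]; ins.
set m5 := upd m4 16 _.
have ag45 : agree scratch m4 m5 by apply: agree_scratch_upd.
have ag5 := agree_trans (agree_trans ag13 ag4) ag45.
have i5 := Inv_agree (agree_volatile (agree_trans ag4 ag45)) i3.
have e5 : (m5 16 == 0) = [&& fresh n zadj D T u, fresh n zadj D T v & zadj u v].
  by rewrite /m5 upd_same e4' addn_eq0 e3 e2 e4 /m1 upd_same eqxx /= andbA.
have m5_8 : m5 8 = u by rewrite ag5.
have m5_9 : m5 9 = v by rewrite ag5.
rewrite /match_step -e5.
apply: wp_seq; apply: wp_if => h16; last first.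
  by do 2!apply: wp_skip; rewrite (negPf h16); split=> //; apply: agree_keep.
have := e5; rewrite h16 eqxx => /esym /and3P[/andP[uT _] /andP[vT _] Zuv].
apply: wp_seq; apply: (wp_mono (wp_push (x := 8) _ i5 _ _)); rewrite ?m5_8 //.
move=> m6 [i6 k6].
have m6_9 : m6 9 = v by rewrite k6.
apply: (wp_mono (wp_push (x := 9) _ i6 _ _)); rewrite ?m6_9 //.
  rewrite mem_rcons inE (negPf vT) orbF.
  by apply/eqP => evu; rewrite evu zadj_irr in Zuv.
move=> m7 [i7 k7]; apply: wp_skip; split=> //.
by apply: keep_trans (agree_keep ag5) (keep_trans k6 k7).
Qed.

Lemma wp_star_code D T m s v c :
  Inv D T m -> m 8 = s -> m 9 = v -> m 15 = c -> s < n -> v < n ->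
  ~~ low n zadj D s -> tour_inv n zadj D (s + (0 < c)) T ->
  let Tc := star_step n zadj D s (T, c) v in
  wp n star_code (fun m' => [/\ Inv D Tc.1 m', m' 15 = Tc.2 &
     forall r, r \in [:: 7; 8; 9] -> m' r = m r]) m.
Proof.
move=> iT m8 m9 m15 sn vn hs ti /=; rewrite /star_code /=; ins.
set m1 := upd m 16 0.
have ag1 : agree scratch m m1 by apply: agree_scratch_upd.
have i1 := Inv_agree (agree_volatile ag1) iT.
have m1_9 : m1 9 = v by rewrite ag1.
apply: wp_seq; apply: (wp_mono (wp_chk (x := 9) _ i1 _)); rewrite ?m1_9 //.
move=> m3 [ag3 e3].
have ag13 := agree_trans ag1 ag3.
have i3 := Inv_agree (agree_volatile ag3) i1.
have m3_8 : m3 8 = s by rewrite ag13.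
have m3_9 : m3 9 = v by rewrite ag13.
have [B3 _ _ _ _] := i3.
apply: wp_seq; apply: (wp_mono (wp_readz B3 _ _)); rewrite ?m3_8 ?m3_9 //.
move=> m4 [ag4 [e4 e4']]; ins; ins; ins.
set m5 := upd _ 16 _.
have ag45 : agree scratch m4 m5 by do 3![apply: agree_upd => //].
have ag5 := agree_trans (agree_trans ag13 ag4) ag45.
have i5 := Inv_agree (agree_volatile (agree_trans ag4 ag45)) i3.
have e5 : (m5 16 == 0) = [&& c < 2, fresh n zadj D T v & zadj s v].
  have -> : m5 16 = m4 16 + m4 10 + (m4 15 - m4 1) by rewrite /m5; upds.
  have -> : m4 15 = c by rewrite (agree_trans ag13 ag4).
  have -> : m4 1 = 1 by rewrite ag4 //; case: B3.
  rewrite e4' !addn_eq0 e3 e4 /m1 upd_same eqxx /= andbC.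
  by congr andb; rewrite subn_eq0 -ltnS.
have m5_8 : m5 8 = s by rewrite ag5.
have m5_9 : m5 9 = v by rewrite ag5.
have m5_15 : m5 15 = c by rewrite ag5.
rewrite -e5.
apply: wp_seq; apply: wp_if => h16; last first.
  do 2!apply: wp_skip; rewrite (negPf h16); split=> // r hr.
  by apply: (agree_keep ag5); move: hr; rewrite !inE => /or3P[] ->; rewrite ?orbT.
have := e5; rewrite h16 eqxx => /esym /and3P[c2 /andP[vT lv] Zsv].
apply: wp_seq; apply: (wp_mono (wp_push (x := 9) _ i5 _ _)); rewrite ?m5_9 //.
move=> m6 [i6 k6].
have m6_8 : m6 8 = s by rewrite k6.
have m6_15 : m6 15 = c by rewrite k6.
apply: wp_seq; apply: (@wp_mono _ _ (fun m' =>
    Inv D (if c == 0 then rcons (rcons T v) s else rcons T v) m' /\ keep m6 m')).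
  apply: wp_if; rewrite m6_15 => c0.
    apply: (wp_mono (wp_push (x := 8) _ i6 _ _)); rewrite ?m6_8 //.
      rewrite mem_rcons inE negb_or; apply/andP; split.
        by apply/eqP => esv; rewrite esv zadj_irr in Zsv.
      by case: ti => _ _ lT; apply/negP => /lT; rewrite (negPf hs) c0 addn0 ltnn.
    by rewrite c0.
  by apply: wp_skip; rewrite (negPf c0).
move=> m7 [i7 k7]; ins; do 2!apply: wp_skip.
have [[_ m7_1 _] _ _ _ _] := i7.
split=> /=.
- by apply: Inv_agree i7; apply: agree_upd.
- by rewrite upd_same k7 // m6_15 m7_1 addn1.
- move=> r hr; have kr : r \in [:: 7; 8; 9; 15].
    by move: hr; rewrite !inE => /or3P[] ->; rewrite ?orbT.
  rewrite upd_ne; last by move: hr; rewrite !inE => /or3P[] /eqP->.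
  by rewrite k7 // k6 // (agree_keep ag5).
Qed.

Lemma Inv01 D T m : Inv D T m -> m 0 = n /\ m 1 = 1.
Proof. by case=> [[h0 h1 _] _ _ _ _]. Qed.

Lemma agree_sub L L' m m' : {subset L <= L'} -> agree L m m' -> agree L' m m'.
Proof. by move=> sL ag x xL; apply: ag; apply: contra xL; apply: sL. Qed.

Lemma wp_star_row_code D Tf m s :
  Inv D Tf.1 m -> m 7 = Tf.2 -> m 8 = s -> s < n -> tour_inv n zadj D s Tf.1 ->
  let Tf' := star_row n zadj D Tf s in
  wp n star_row_code (fun m' => [/\ Inv D Tf'.1 m', m' 7 = Tf'.2 & m' 8 = s]) m.
Proof.
move=> iT m7 m8 sn ti /=; have hb : 16 < n * n by nia.
have [_ [_ _ h4 hd] [h5 _ _ _] _ _] := iT.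
rewrite /star_row_code /=; ins; ins; rewrite h4 m8 hd //; ins; rewrite h5.
set m1 := upd _ 10 (D - _).
have ag1 : agree scratch m m1 by do 3![apply: agree_upd => //].
have i1 := Inv_agree (agree_volatile ag1) iT.
have m1_10 : m1 10 = D - dg s by rewrite /m1 upd_same.
apply: wp_seq; apply: wp_if; rewrite m1_10 => hD; last first.
  have ls : low n zadj D s by rewrite /low; lia.
  by do 2!apply: wp_skip; rewrite /star_row ls !ag1.
have hs : ~~ low n zadj D s by rewrite /low; lia.
rewrite /star_row (negPf hs) /=; ins.
set m2 := upd m1 15 0.
have i2 : Inv D Tf.1 m2 by apply: Inv_agree i1; apply: agree_upd.
pose F i := foldl (star_step n zadj D s) (Tf.1, 0) (iota 0 i).
apply: wp_seq; apply: (@wp_for 9 _ (fun i m' => [/\ Inv D (F i).1 m', m' 15 = (F i).2,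
  m' 7 = Tf.2 & m' 8 = s])) => //.
- by move=> i m' [/Inv01].
- move=> i m' m'' ag [iF f15 f7 f8]; rewrite !ag //; split=> //.
  apply: Inv_agree iF; apply: agree_sub ag => x; rewrite !inE.
  by case/orP=> /eqP->.
- move=> i m' lt_i [iF f15 f7 f8] m9.
  have ti' := star_prefix_inv sn hs ti (ltnW lt_i).
  apply: (wp_mono (wp_star_code iF f8 m9 f15 sn lt_i hs ti')).
  rewrite -/(F i) -surjective_pairing /F foldl_iotaS -/(F i).
  by move=> m'' [iF' f15' k]; split; [split=> //|]; rewrite k.
move=> m3 [i3 f15 f7 f8]; have -> : star n zadj D s Tf.1 = F n by [].
ins; ins; ins; do 2!apply: wp_skip; split; upds => //.
  by apply: Inv_agree i3; do 3![apply: agree_upd => //].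
by rewrite f7 f15.
Qed.

Lemma wp_fill_code D T m u :
  Inv D T m -> m 8 = u -> u < n ->
  wp n fill_code (fun m' => Inv D (fill_step T u) m' /\ keep m m') m.
Proof.
move=> iT m8 un; have hb : 16 < n * n by nia.
have [_ [_ h3 _ _] [_ _ _ hu] _ _] := iT.
rewrite /fill_code /=; ins; ins; rewrite h3 m8 hu //.
set m1 := upd _ 10 _.
have ag1 : agree scratch m m1 by do 2![apply: agree_upd => //].
have i1 := Inv_agree (agree_volatile ag1) iT.
have m1_10 : m1 10 = (u \in T) by rewrite /m1 upd_same.
have m1_8 : m1 8 = u by rewrite ag1.
apply: wp_seq; apply: wp_if; rewrite m1_10 /fill_step; last first.
  by rewrite eqb0 negbK => ->; do 2!apply: wp_skip; split=> //; apply: agree_keep.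
move=> /eqP; rewrite eqb0 => uT; rewrite (negPf uT).
apply: (wp_mono (wp_push (x := 8) _ i1 _ _)); rewrite ?m1_8 //.
move=> m2 [i2 k2]; apply: wp_skip; split=> //.
exact: keep_trans (agree_keep ag1) k2.
Qed.

Lemma agree_loop r m m' : r \in volatile -> agree [:: r; 14] m m' -> agree volatile m m'.
Proof.
move=> hr; apply: agree_sub => x; rewrite inE => /orP[/eqP->//|].
by rewrite inE => /eqP->.
Qed.

Lemma wp_match_phase D m :
  Inv D [::] m -> m 7 = 0 ->
  wp n (For 8 (For 9 match_code))
    (fun m' => Inv D (matching_phase n zadj D) m' /\ m' 7 = 0) m.
Proof.
move=> iT m7.
pose F i := foldl (match_row n zadj D) [::] (iota 0 i).
apply: (@wp_for 8 _ (fun i m' => Inv D (F i) m' /\ m' 7 = 0)) => //.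
- by move=> i m' [/Inv01].
- move=> i m' m'' ag [iF f7]; rewrite ag //; split=> //.
  by apply: Inv_agree iF; apply: agree_loop ag.
move=> u {iT m7}m un [iF m7] m8.
pose G i := foldl (match_step n zadj D u) (F u) (iota 0 i).
apply: (@wp_for 9 _ (fun i m' => [/\ Inv D (G i) m', m' 7 = 0 & m' 8 = u])) => //.
- by move=> i m' [/Inv01].
- move=> i m' m'' ag [iG f7 f8]; rewrite !ag //; split=> //.
  by apply: Inv_agree iG; apply: agree_loop ag.
- move=> v {iF m7 m8}m vn [iG m7 m8] m9.
  apply: (wp_mono (wp_match_code iG m8 m9 un vn)) => m' [iG' k].
  by rewrite /G foldl_iotaS -/(G v) !k.
- by move=> m' [iG f7 f8]; rewrite /F foldl_iotaS.
Qed.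

Lemma wp_star_phase D m :
  Inv D (matching_phase n zadj D) m -> m 7 = 0 ->
  wp n (For 8 star_row_code) (fun m' => Inv D (star_phase n zadj D).1 m' /\
    m' 7 = defect n zadj D) m.
Proof.
move=> iT m7.
pose F i := foldl (star_row n zadj D) (matching_phase n zadj D, 0) (iota 0 i).
apply: (@wp_for 8 _ (fun i m' => Inv D (F i).1 m' /\ m' 7 = (F i).2)) => //.
- by move=> i m' [/Inv01].
- move=> i m' m'' ag [iF f7]; rewrite ag //; split=> //.
  by apply: Inv_agree iF; apply: agree_loop ag.
move=> s {iT m7}m sn [iF m7] m8.
have ti := star_phase_prefix_inv zadj_irr D (ltnW sn).
apply: (wp_mono (wp_star_row_code iF m7 m8 sn ti)) => m' [iF' f7 f8].
by rewrite /F foldl_iotaS.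
Qed.

Lemma wp_attempt D m :
  Base m -> Tables m -> m 5 = D ->
  wp n attempt (fun m' => Inv D (tour n zadj D) m' /\ m' 7 = defect n zadj D) m.
Proof.
move=> hB hT h5; rewrite /attempt /=; ins; ins.
have hb : 16 < n * n by nia.
apply: wp_seq; apply: (@wp_for 8 _ (fun i m' =>
   [/\ Base m', Tables m', [/\ m' 5 = D, m' 6 = 0 & m' 7 = 0] &
       forall v, v < i -> v < n -> m' (n * n + 1 + n + v) = 0])) => //.
- by move=> i m' [[]].
- move=> i m' m'' ag0 [hB' hT' [f5 f6 f7] hu].
  have ag := agree_loop (isT : 8 \in volatile) ag0.
  split; [exact: Base_agree hB' | exact: Tables_agree hT' | by rewrite !ag0 |].
  by move=> v hv vn; rewrite ag ?hu //; apply: volatile_lt; lia.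
- case: hB => [h0 h1 hi]; case: hT => [h2 h3 h4 hd]; split=> //.
  + by split; upds => // a ha; rewrite -hi //; upds.
  + by split; upds => // v hv; rewrite -hd //; upds.
- move=> u m' un [[h0 h1 hi] [h2 h3 h4 hd] [f5 f6 f7] hu] m8.
  rewrite /reset_code /=; do 3 ins; rewrite h3 m8; apply: wp_skip; split; upds => //.
  split.
  + by split; upds => // a ha; rewrite -hi //; upds.
  + by split; upds => // v hv; rewrite -hd //; upds.
  + by split; upds.
  + move=> v; rewrite ltnS leq_eqVlt => /orP[/eqP->|lt_v] vn; first by upds.
    by upds; apply: hu.
move=> m2 [hB2 hT2 [f5 f6 f7] hu].
have i2 : Inv D [::] m2.
  by split=> //; split=> // v vn; rewrite hu.
apply: wp_seq; apply: (wp_mono (wp_match_phase i2 f7)) => m3 [i3 f73].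
apply: wp_seq; apply: (wp_mono (wp_star_phase i3 f73)) => m4 [i4 f74].
pose F i := foldl fill_step (star_phase n zadj D).1 (iota 0 i).
apply: wp_seq; apply: (@wp_for 8 _ (fun i m' => Inv D (F i) m' /\
    m' 7 = defect n zadj D)) => //.
- by move=> i m' [/Inv01].
- move=> i m' m'' ag [iF f7']; rewrite ag //; split=> //.
  by apply: Inv_agree iF; apply: agree_loop ag.
- move=> s m' sn [iF f7'] f8.
  apply: (wp_mono (wp_fill_code iF f8 sn)) => m'' [iF' k].
  by rewrite /F foldl_iotaS !k.
- by move=> m' h; apply: wp_skip.
Qed.

Definition Addresses (m : memory) : Prop :=
  [/\ m 2 = n * n + 1, m 3 = n * n + 1 + n & m 4 = n * n + 1 + n + n].

Lemma Addresses_agree m m' : agree volatile m m' -> Addresses m -> Addresses m'.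
Proof. by move=> ag [h2 h3 h4]; split; rewrite ag. Qed.

Lemma wp_deg_code m u v (d : nat -> nat) :
  Base m -> Addresses m -> m 8 = u -> m 9 = v -> u < n -> v < n ->
  (forall x, x < n -> m (n * n + 1 + n + n + x) = d x) ->
  wp n deg_code (fun m' => [/\ Base m', Addresses m', m' 8 = u, m' 9 = v &
    forall x, x < n -> m' (n * n + 1 + n + n + x) =
                       d x + ((x == u) && zadj u v)]) m.
Proof.
move=> hB hA m8 m9 un vn hd; have hb : 16 < n * n by nia.
rewrite /deg_code /=; apply: wp_seq.
apply: (wp_mono (wp_readz hB _ _)); rewrite ?m8 ?m9 // => m1 [ag [e1 _]].
have ag' := agree_volatile ag.
have hB1 := Base_agree ag' hB; have hA1 := Addresses_agree ag' hA.
have hd1 x : x < n -> m1 (n * n + 1 + n + n + x) = d x.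
  by move=> xn; rewrite ag ?hd //; apply: scratch_lt; lia.
have [m18 m19] : m1 8 = u /\ m1 9 = v by rewrite !ag.
case: (hB1) => h0 h1 hi; case: (hA1) => h2 h3 h4.
rewrite -e1; apply: wp_seq; apply: wp_if => h10; last first.
  do 2!apply: wp_skip; rewrite (negPf h10); split=> // x xn.
  by rewrite andbF addn0 hd1.
rewrite h10 eqxx.
ins; ins; rewrite h4 m18 hd1 //; ins; ins; rewrite h1; do 2!apply: wp_skip.
split; upds => //.
- by split; upds => // a ha; rewrite -hi //; upds.
- by split; upds.
- move=> x xn; rewrite andbT; case: (eqVneq x u) => [->|xu]; first by upds.
  by move/eqP: xu => xu; upds; rewrite addn0 hd1.
Qed.

Lemma wp_deg_phase m :
  Base m -> Addresses m -> (forall x, x < n -> m (n * n + 1 + n + n + x) = 0) ->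
  wp n (For 8 (For 9 deg_code)) (fun m' => Base m' /\ Tables m') m.
Proof.
move=> hB hA hd.
have st (d : nat -> nat) m1 m2 : agree volatile m1 m2 ->
    (forall x, x < n -> m1 (n * n + 1 + n + n + x) = d x) ->
    (forall x, x < n -> m2 (n * n + 1 + n + n + x) = d x).
  by move=> ag h x xn; rewrite ag ?h //; apply: volatile_lt; nia.
apply: (@wp_for 8 _ (fun i m' => [/\ Base m', Addresses m' &
  forall x, x < n -> m' (n * n + 1 + n + n + x) = if x < i then dg x else 0])) => //.
- by move=> i m' [[]].
- move=> i m' m'' /(agree_loop (isT : 8 \in volatile)) ag [hB' hA' hd'].
  split; [exact: Base_agree hB' | exact: Addresses_agree hA' |].
  exact: (st (fun x => if x < i then dg x else 0) _ _ ag hd').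
- move=> u {hB hA hd}m un [hB hA hd] m8.
  apply: (@wp_for 9 _ (fun i m' => [/\ Base m', Addresses m', m' 8 = u &
    forall x, x < n -> m' (n * n + 1 + n + n + x) =
      if x < u then dg x else if x == u then count (zadj u) (iota 0 i) else 0])) => //.
  + by move=> i m' [[]].
  + move=> i m' m'' ag0 [hB' hA' m8' hd']; have ag := agree_loop (isT : 9 \in volatile) ag0.
    split; [exact: Base_agree hB' | exact: Addresses_agree hA' | by rewrite ag0 |].
    exact: (st (fun x => if x < u then dg x else
      if x == u then count (zadj u) (iota 0 i) else 0) _ _ ag hd').
  + split=> // x xn; rewrite hd //; case: ifP => // _; case: ifP => //.
  + move=> v m' vn [hB' hA' m8' hd'] m9'.
    apply: (wp_mono (wp_deg_code (d := fun x => if x < u then dg x else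
      if x == u then count (zadj u) (iota 0 v) else 0) hB' hA' m8' m9' un vn hd')).
    move=> m'' [hB'' hA'' m8'' m9'' hd'']; split=> //; split=> // x xn.
    rewrite hd'' // -[v.+1]addn1 iotaD count_cat /= addn0 add0n.
    by case: ltngtP => //= _; rewrite addn0.
  + move=> m' [hB' hA' m8' hd']; split=> //; split=> // x xn; rewrite hd' // ltnS.
    by case: ltngtP => //= ->.
- move=> m' [hB' [h2 h3 h4] hd']; split=> //; split=> // x xn.
  by rewrite hd' // xn.
Qed.

Lemma wp_main m :
  m 0 = n -> m 1 = 1 -> m 2 = n * n + 1 ->
  (forall a, 16 < a -> m a = init_mem w a) ->
  wp n main_code (fun m' => exists D, [/\ defect n zadj D = 0,
    forall D', D' < D -> defect n zadj D' <> 0 &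
    forall k, k < n -> m' (1 + n * n + k) = nth 0 (tour n zadj D) k]) m.
Proof.
move=> h0 h1 h2 hi; have hb : 16 < n * n by nia.
rewrite /main_code /=; ins; ins.
apply: wp_seq; apply: (wp_mono (wp_deg_phase _ _ _)).
- by split; upds => // a ha; upds; apply: hi; lia.
- by split; upds; rewrite ?h2 ?h0.
- move=> x xn; upds; rewrite hi; last by lia.
  by rewrite /init_mem ifN ?ifN //; lia.
move=> m1 [hB hT]; ins.
set m2 := upd m1 5 0.
have hB2 : Base m2.
  by case: hB => [g0 g1 gi]; split; rewrite /m2; upds => // a ha; rewrite -gi //; upds.
have hT2 : Tables m2.
  by case: hT => [g2 g3 g4 gd]; split; rewrite /m2; upds => // v hv; rewrite -gd //; upds.
(* Register 5 is the round number and all smaller thresholds have failed, so leaving the loop yields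
   the least successful one. *)
apply: wp_seq; apply: (@wp_loop n _ _ _ n.+1 (fun i m' => [/\ Base m', Tables m',
   m' 5 = i & forall D', D' < i -> defect n zadj D' <> 0])) => //.
move=> i m' lei [hB' hT' f5 hD].
apply: (wp_mono (wp_attempt hB' hT' f5)) => m'' [[hB'' hT'' hR _ _] f7].
split; rewrite f7 => d0.
  apply: wp_skip; exists i; split=> // k kn; rewrite [1 + _]addnC.
  case: hR => _ _ + _; apply.
  by rewrite (perm_size (tour_perm n zadj_irr i)) size_iota.
split.
  rewrite ltn_neqAle lei andbT; apply: contra d0 => /eqP->.
  by rewrite defect_large.
case: hB'' => [g0 g1 gi]; case: hT'' => [g2 g3 g4 gd]; case: hR => [g5 _ _ _].
eapply wp_ins; first by [].
split; upds => //.
- by split; upds => // a ha; rewrite -gi //; upds.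
- by split; upds => // v hv; rewrite -gd //; upds.
- by rewrite g5 g1 addn1.
- move=> D'; rewrite ltnS leq_eqVlt => /orP[/eqP->|/hD //]; exact/eqP.
Qed.

End Refine.

Lemma wp_tsp_code (n : nat) (w : instance n) :
  4 <= n ->
  wp n tsp_code (fun m' => exists T,
    [/\ perm_eq T (iota 0 n), forall k, k < n -> m' (1 + n * n + k) = nth 0 T k &
        16 <= n -> exists D, [/\ T = tour n (zadj w) D, defect n (zadj w) D = 0 &
                       forall D', D' < D -> defect n (zadj w) D' <> 0]])
    (init_mem w).
Proof.
move=> n4; have hb : 16 <= n * n by nia.
have h0 : init_mem w 0 = n by [].
rewrite /tsp_code /=; ins; ins; apply: wp_seq.
apply: (@wp_for n 8 _ (fun i m' => [/\ m' 0 = n, m' 1 = 1, m' 11 = 1 + i * n &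
   forall a, 16 < a -> m' a = init_mem w a])) => //.
- by move=> i m' [].
- move=> i m' m'' ag [f0 f1 f11 fa]; rewrite !ag //; split=> // a ha.
  by rewrite ag ?fa // !inE; lia.
- by split; upds => // a ha; upds.
- move=> i m' lt_i [f0 f1 f11 fa] f8; eapply wp_ins; first by [].
  split; upds => //; split; upds => //; first by rewrite f11 f0 mulSn; lia.
  by move=> a ha; upds; apply: fa.
move=> m1 [f0 f1 f11 fa]; do 4 ins; rewrite f11 f0 addn0.
set m2 := upd _ 10 (16 - n).
have f0' : m2 0 = n by rewrite /m2; upds.
have f1' : m2 1 = 1 by rewrite /m2; upds.
have f2' : m2 2 = n * n + 1 by rewrite /m2; upds; rewrite addnC.
have fa' a : 16 < a -> m2 a = init_mem w a by move=> ha; rewrite /m2; upds; apply: fa.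
apply: wp_seq; apply: wp_if; rewrite /m2 upd_same -/m2 => h16.
  have n16 : 16 <= n by lia.
  apply: (wp_mono (wp_main n16 f0' f1' f2' fa')) => m' [D [d0 dD hk]].
  apply: wp_skip; exists (tour n (zadj w) D); split; last by exists D.
    by apply: tour_perm; apply: zadj_irr.
  exact: hk.
apply: (@wp_for n 8 _ (fun i m' => [/\ m' 0 = n, m' 1 = 1, m' 2 = n * n + 1 &
   forall k, k < i -> k < n -> m' (n * n + 1 + k) = k])) => //.
- by move=> i m' [].
- move=> i m' m'' ag [g0 g1 g2 gk]; rewrite !ag //; split=> // a ha an.
  by rewrite ag ?gk // !inE; lia.
- move=> i m' lt_i [g0 g1 g2 gk] m8; rewrite /=; ins; ins; apply: wp_skip.
  rewrite g2 m8; split; upds => //; split; upds => // k.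
  rewrite ltnS leq_eqVlt => /orP[/eqP->|lt_k] kn; first by upds.
  by upds; apply: gk.
move=> m3 [_ _ _ gk]; apply: wp_skip; exists (iota 0 n); split=> //; last by lia.
by move=> k kn; rewrite nth_iota // add0n (addnC 1) gk.
Qed.

(** * Polynomial bound on the running time *)

Fixpoint weight (c : com) : nat :=
  match c with
  | Ins _ => 1
  | Skip => 0
  | Seq c1 c2 => weight c1 + weight c2
  | If _ c1 c2 => (weight c1 + weight c2).+2
  | Loop p _ b => (weight p + weight b).+2
  end.

Fixpoint depth (c : com) : nat :=
  match c with
  | Ins _ | Skip => 0
  | Seq c1 c2 | If _ c1 c2 => maxn (depth c1) (depth c2)
  | Loop p _ b => (maxn (depth p) (depth b)).+1
  end.

Lemma cost_le N c : cost N c <= weight c * expn N.+2 (depth c).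
Proof.
have pos k : 0 < expn N.+2 k by rewrite expn_gt0.
have mono a b k : a <= weight b * expn N.+2 (depth b) -> depth b <= k ->
    a <= weight b * expn N.+2 k.
  move=> le_a le_k; apply: leq_trans le_a _.
  by rewrite leq_mul2l leq_pexp2l ?orbT.
elim: c => [i|//|c1 IH1 c2 IH2|r c1 IH1 c2 IH2|p IHp r b IHb] //=.
- by rewrite mulnDl leq_add // mono ?leq_maxl ?leq_maxr.
- rewrite -addn2 -[X in _ <= X * _]addn2 !mulnDl leq_add //; last first.
    by rewrite -{1}[2]muln1 leq_mul2l pos orbT.
  by rewrite leq_add // mono ?leq_maxl ?leq_maxr.
- rewrite expnS mulnCA leq_mul2l /= -addn2 -[X in _ <= X * _]addn2 !mulnDl leq_add //.
    by rewrite leq_add // mono ?leq_maxl ?leq_maxr.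
  by rewrite -{1}[2]muln1 leq_mul2l pos orbT.
Qed.

(** The nested loops are the threshold search, two vertex scans and the address computation in
    [readz]; each contributes a factor n + 2. *)
Lemma depth_tsp_code : depth tsp_code = 4.
Proof. by []. Qed.

(** * Random orderings *)

Section PrescribedValues.
Variable T : finType.

(** Multiplying by the inverse of one solution turns all solutions into permutations that fix [ps]
    pointwise. *)
Lemma card_perm_prescribed (ps vs : seq T) : uniq ps ->
  #|[set s : {perm T} | map s ps == vs]| <= (#|T| - size ps)`!.
Proof.
move=> ups; case: (set_0Vmem [set s : {perm T} | map s ps == vs]) => [->|[s0]].
  by rewrite cards0.
rewrite inE => /eqP es0.
have -> : #|T| - size ps = #|~: [set x in ps]|.
  by rewrite cardsCs setCK cardsE (card_uniqP ups).
rewrite -card_perm -(card_imset _ (mulIg s0^-1%g)).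
apply: subset_leq_card; apply/subsetP => t /imsetP[s]; rewrite inE => /eqP es ->.
apply/subsetP => x; rewrite !inE permM => /negP h; apply/negP => xps; apply: h.
have: map s ps = map s0 ps by rewrite es es0.
by move=> /eq_in_map -> //; rewrite permK.
Qed.

Lemma card_perm_pred (U : finType) (f : {perm T} -> U) (P : pred U) K :
  (forall u, P u -> #|[set s | f s == u]| <= K) ->
  #|[set s | P (f s)]| <= #|[set u | P u]| * K.
Proof.
move=> hK; rewrite -sum1_card (partition_big f P) => [|s]; last by rewrite inE.
rewrite -sum_nat_const; under [X in _ <= X]eq_bigl do rewrite inE.
apply: leq_sum => u Pu; apply: leq_trans (hK u Pu).
rewrite -sum1_card big_mkcond [X in _ <= X]big_mkcond; apply: leq_sum => s _.
by rewrite !inE; case: (P _); case: (f s == u).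
Qed.

End PrescribedValues.

Lemma card_ordered_pairs (T : finType) (A : {set T}) :
  #|A| * #|A|.-1 = \sum_i \sum_(j | j != i) ((i \in A) && (j \in A)).
Proof.
rewrite -sum_nat_const big_mkcond /=; apply: eq_bigr => i _.
case: ifP => iA; last by rewrite big1.
have -> : #|A|.-1 = #|A :\ i| by rewrite (cardsD1 i A) iA.
rewrite -sum1_card big_mkcond [RHS]big_mkcond /=.
by apply: eq_bigr => j _; rewrite !inE; case: (j == i); case: (j \in A).
Qed.

(** * Second moment of the number of arcs along a random ordering *)

Section Counting.
Variables (n : nat) (E : rel 'I_n) (D : nat).
Hypothesis n4 : 4 <= n.
Hypothesis degE : forall x, #|[set y | E x y]| <= D.

(** Pairs are ordered, as an ordering may traverse an edge either way; for symmetric [E] each edge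
    counts twice. *)
Definition arcs : nat := #|[set p : 'I_n * 'I_n | E p.1 p.2]|.

Lemma card_two_paths :
  #|[set p : 'I_n * 'I_n * 'I_n | E p.1.1 p.1.2 && E p.1.2 p.2]| <= arcs * D.
Proof.
rewrite -sum1_card (partition_big (fun p => p.1) (fun q => E q.1 q.2)); last first.
  by move=> p; rewrite inE => /andP[].
rewrite /arcs -sum_nat_const; under [X in _ <= X]eq_bigl do rewrite inE.
apply: leq_sum => -[x y] /= Exy; apply: leq_trans (degE y).
rewrite -sum1_card (reindex_onto (fun z => (x, y, z)) (fun p => p.2)) /=; last first.
  by move=> [[x' y'] z] /= /andP[_ /eqP[-> ->]].
apply: eq_leq; apply: eq_bigl => z.
by rewrite !inE /= Exy !eqxx !andbT.
Qed.

Definition arcs_along (s : {perm 'I_n}) : {set 'I_n} :=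
  [set i | E (s i) (s (ordS i))].

Lemma val_ordS (i : 'I_n) : val (ordS i) = if i.+1 == n then 0 else i.+1.
Proof.
rewrite /=; case: eqP => [->|ne]; first by rewrite modnn.
by rewrite modn_small // ltn_neqAle; apply/andP; split=> //; apply/eqP.
Qed.

Lemma ordS_neq (i : 'I_n) : ordS i != i.
Proof. by rewrite -val_eqE val_ordS /=; case: (eqVneq i.+1 n); lia. Qed.

Lemma ordSS_neq (i : 'I_n) : ordS (ordS i) != i.
Proof.
rewrite -val_eqE !val_ordS /=; case: (eqVneq i.+1 n) => h.
  by case: (eqVneq 1 n); lia.
by case: (eqVneq i.+2 n); lia.
Qed.

Lemma ordS_inj_n : injective (@ordS n).
Proof. exact: (can_inj (@ordSK n)). Qed.

(** Adjacent positions share a vertex, so three prescribed places carry a path of two arcs, and the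
    degree bound leaves few such paths. *)
Lemma card_consecutive_arcs (i : 'I_n) :
  #|[set s | (i \in arcs_along s) && (ordS i \in arcs_along s)]|
    <= arcs * D * (n - 3)`!.
Proof.
pose f (s : {perm 'I_n}) := (s i, s (ordS i), s (ordS (ordS i))).
pose P (p : 'I_n * 'I_n * 'I_n) := E p.1.1 p.1.2 && E p.1.2 p.2.
have -> : [set s | (i \in arcs_along s) && (ordS i \in arcs_along s)] =
          [set s | P (f s)] by apply/setP => s; rewrite !inE.
apply: (@leq_trans (#|[set p | P p]| * (n - 3)`!)); last first.
  by rewrite leq_mul2r card_two_paths orbT.
apply: card_perm_pred => -[[x y] z] _.
have u3 : uniq [:: i; ordS i; ordS (ordS i)].
  rewrite /= !inE !negb_or eq_sym ordS_neq eq_sym ordSS_neq.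
  by rewrite eq_sym ordS_neq.
have := card_perm_prescribed [:: x; y; z] u3; rewrite card_ord /=.
apply: leq_trans; apply: subset_leq_card; apply/subsetP => s.
by rewrite !inE /f => /eqP[-> -> ->].
Qed.

Lemma card_separate_arcs (i j : 'I_n) :
  i != j -> j != ordS i -> i != ordS j ->
  #|[set s | (i \in arcs_along s) && (j \in arcs_along s)]|
    <= arcs * arcs * (n - 4)`!.
Proof.
move=> ij jSi iSj.
pose f (s : {perm 'I_n}) := ((s i, s (ordS i)), (s j, s (ordS j))).
pose P (p : 'I_n * 'I_n * ('I_n * 'I_n)) := E p.1.1 p.1.2 && E p.2.1 p.2.2.
have -> : [set s | (i \in arcs_along s) && (j \in arcs_along s)] =
          [set s | P (f s)] by apply/setP => s; rewrite !inE.
apply: (@leq_trans (#|[set p | P p]| * (n - 4)`!)); last first.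
  rewrite leq_mul2r -cardsX; apply/orP; right; apply: subset_leq_card.
  by apply/subsetP => p; rewrite !inE.
apply: card_perm_pred => -[[x y] [z t]] _.
have u4 : uniq [:: i; ordS i; j; ordS j].
  rewrite /= !inE !negb_or eq_sym ordS_neq ij iSj eq_sym jSi.
  by rewrite (inj_eq ordS_inj_n) ij eq_sym ordS_neq.
have := card_perm_prescribed [:: x; y; z; t] u4; rewrite card_ord /=.
apply: leq_trans; apply: subset_leq_card; apply/subsetP => s.
by rewrite !inE /f => /eqP[-> -> -> ->].
Qed.

(** For each position two others are adjacent to it, and n - 3 share no vertex with it; this factor
    turns (n - 4)! into (n - 3)!. *)
Lemma arcs_second_moment :
  \sum_(s : {perm 'I_n}) #|arcs_along s| * #|arcs_along s|.-1
    <= n * (n - 3)`! * (2 * (arcs * D) + arcs * arcs).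
Proof.
pose c i j := #|[set s | (i \in arcs_along s) && (j \in arcs_along s)]|.
have -> : \sum_(s : {perm 'I_n}) #|arcs_along s| * #|arcs_along s|.-1 =
          \sum_i \sum_(j | j != i) c i j.
  transitivity (\sum_(s : {perm 'I_n}) \sum_i \sum_(j | j != i)
      ((i \in arcs_along s) && (j \in arcs_along s) : nat)).
    by apply: eq_bigr => s _; rewrite card_ordered_pairs.
  rewrite exchange_big; apply: eq_bigr => i _; rewrite exchange_big.
  apply: eq_bigr => j _; rewrite /c -sum1_card [RHS]big_mkcond /=.
  by apply: eq_bigr => s _; rewrite !inE; case: (_ && _).
rewrite -mulnA -[X in _ <= X * _](card_ord n) -sum_nat_const.
apply: leq_sum => i _.
have pi : ordS (ord_pred i) = i by exact: ord_predK.
have ne1 : ordS i != i := ordS_neq i.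
have ne2 : ord_pred i != i by rewrite -{2}pi eq_sym ordS_neq.
have ne3 : ord_pred i != ordS i.
  by rewrite -{2}pi eq_sym ordSS_neq.
rewrite (bigD1 (ordS i)) //= (bigD1 (ord_pred i)) /=; last by rewrite ne2.
have h1 : c i (ordS i) <= arcs * D * (n - 3)`! by apply: card_consecutive_arcs.
have h2 : c i (ord_pred i) <= arcs * D * (n - 3)`!.
  rewrite /c -{1}pi; apply: leq_trans (card_consecutive_arcs (ord_pred i)).
  by apply: eq_leq; apply: eq_card => s; rewrite !inE andbC.
have h3 : \sum_(j | (j != i) && (j != ordS i) && (j != ord_pred i)) c i j
    <= (n - 3) * (arcs * arcs * (n - 4)`!).
  apply: (@leq_trans (\sum_(j | (j != i) && (j != ordS i) && (j != ord_pred i))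
      (arcs * arcs * (n - 4)`!))).
    apply: leq_sum => j /andP[/andP[ji jS] jp].
    apply: card_separate_arcs => //; first by rewrite eq_sym.
    by rewrite -{1}pi (inj_eq ordS_inj_n) eq_sym.
  rewrite sum_nat_const leq_mul2r; apply/orP; right.
  have u3 : uniq [:: i; ordS i; ord_pred i].
    by rewrite /= !inE !negb_or eq_sym ne1 eq_sym ne2 eq_sym ne3.
  pose A := [set x in [:: i; ordS i; ord_pred i]].
  have cA : #|A| = 3 by rewrite cardsE (card_uniqP u3).
  have := cardsC A; rewrite card_ord cA => cC.
  apply: (@leq_trans #|~: A|); last by rewrite -[X in _ <= X - _]cC addKn.
  by apply: eq_leq; apply: eq_card => j; rewrite !inE !negb_or andbA.
have f3 : (n - 3)`! = (n - 3) * (n - 4)`!.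
  by have -> : n - 3 = (n - 4).+1 by [lia]; rewrite factS.
apply: leq_trans (leq_add h1 (leq_add h2 h3)) _; rewrite f3.
by move: (n - 3) ((n - 4)`!) arcs => a b e; nia.
Qed.

(* The second moment gives [P(X >= g + 1) <= E[X (X - 1)] / (g (g + 1))]. *)
Lemma card_many_arcs g : 0 < g -> arcs <= 4 * g * D ->
  #|[set s | g < #|arcs_along s| ]| * ((n - 1) * (n - 2)) <= 16 * (D * D) * n`!.
Proof.
move=> g0 leA; set B := #|_|.
have h1 : B * (g.+1 * g) <= n * (n - 3)`! * (2 * (arcs * D) + arcs * arcs).
  apply: leq_trans arcs_second_moment.
  rewrite /B -sum_nat_const big_mkcond /=; apply: leq_sum => s _.
  by rewrite inE; case: ifP => // gX; apply: leq_mul => //; lia.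
have f3 : n`! = n * ((n - 1) * ((n - 2) * (n - 3)`!)).
  case: n n4 => [|[|[|k]]] // _.
  by rewrite !subSS !subn0 !factS.
(* Consecutive pairs give at most 8 g D^2 and separate ones 16 g^2 D^2, together at most 16 g (g +
   1) D^2. *)
have h2 : 2 * (arcs * D) + arcs * arcs <= 16 * (g.+1 * g) * (D * D).
  have -> : 16 * (g.+1 * g) * (D * D) = 16 * g * D * D + (4 * g * D) * (4 * g * D).
    by nia.
  apply: leq_add; last exact: leq_mul.
  have : arcs * D <= 4 * g * D * D by rewrite leq_mul2r leA orbT.
  by nia.
have gg : 0 < g.+1 * g by rewrite muln_gt0.
rewrite -(leq_pmul2r gg) f3.
have -> : 16 * (D * D) * (n * ((n - 1) * ((n - 2) * (n - 3)`!))) * (g.+1 * g) =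
  (n * (n - 3)`! * (16 * (g.+1 * g) * (D * D))) * ((n - 1) * (n - 2)) by nia.
rewrite mulnAC leq_mul2r; apply/orP; right.
apply: leq_trans h1 _; by rewrite leq_mul2l h2 orbT.
Qed.

End Counting.

(** * Hamilton cycles and vertex orderings *)

Lemma cycle_edgesM n (s t : {perm 'I_n}) :
  cycle_edges (s * t)%g = [set t @: e | e : {set 'I_n} in cycle_edges s].
Proof.
rewrite /cycle_edges -imset_comp; apply: eq_imset => i /=.
by rewrite imsetU !imset_set1 !permM.
Qed.

Lemma cycle_edges_eqM n (s1 s2 t : {perm 'I_n}) :
  (cycle_edges (s1 * t)%g == cycle_edges (s2 * t)%g) =
  (cycle_edges s1 == cycle_edges s2).
Proof.
apply/eqP/eqP => [h|h]; last by rewrite !cycle_edgesM h.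
by rewrite -[s1](mulgK t) -[s2](mulgK t) cycle_edgesM h -cycle_edgesM.
Qed.

(** Right multiplication relabels vertices and carries one fibre of [cycle_edges] onto another. A
    uniform ordering thus induces a uniform Hamilton cycle, and the fibre size itself is never
    computed. *)
Lemma card_cycle_fiber n (s0 : {perm 'I_n}) :
  #|[set s | cycle_edges s == cycle_edges s0]| =
  #|[set s | cycle_edges s == cycle_edges (1%g : {perm 'I_n})]|.
Proof.
rewrite -(card_imset _ (mulIg s0^-1%g)); apply: eq_card => s; rewrite inE.
apply/imsetP/idP => [[s1]|h].
  rewrite inE => h ->; rewrite -(cycle_edges_eqM _ _ s0).
  by rewrite mulgKV mul1g.
exists (s * s0)%g; last by rewrite mulgK.
by rewrite inE -[X in _ == cycle_edges X]mul1g cycle_edges_eqM.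
Qed.

Lemma card_ham_perm n (P : pred {set {set 'I_n}}) :
  #|[set s : {perm 'I_n} | P (cycle_edges s)]| =
  #|[set H in ham_cycles n | P H]| *
  #|[set s | cycle_edges s == cycle_edges (1%g : {perm 'I_n})]|.
Proof.
rewrite -sum1_card (partition_big (@cycle_edges n)
  (fun H => H \in [set H in ham_cycles n | P H])); last first.
  move=> s; rewrite !inE => ->; rewrite andbT; apply/existsP; by exists s.
rewrite -sum_nat_const; apply: eq_bigr => H.
rewrite !inE => /andP[/existsP[s0 /eqP->] PH].
rewrite -(card_cycle_fiber s0) -sum1_card; apply: eq_bigl => s; rewrite !inE.
by case: eqP => [->|]; rewrite ?PH ?andbF.
Qed.

Lemma ham_cycles_fraction n (P : pred {set {set 'I_n}}) :
  #|[set H in ham_cycles n | P H]| * n`! =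
  #|[set s : {perm 'I_n} | P (cycle_edges s)]| * #|ham_cycles n|.
Proof.
have := card_ham_perm (fun _ : {set {set 'I_n}} => true).
have -> : [set s : {perm 'I_n} | true] = [set: {perm 'I_n}].
  by apply/setP => s; rewrite !inE.
have -> : [set H in ham_cycles n | true] = ham_cycles n.
  by apply/setP => H; rewrite !inE andbT.
rewrite cardsT card_Sn => ->; rewrite card_ham_perm; lia.
Qed.

Lemma card_ham_cycles_gt0 n : 0 < #|ham_cycles n|.
Proof.
apply/card_gt0P; exists (cycle_edges (1%g : {perm 'I_n})).
by rewrite inE; apply/existsP; exists 1%g.
Qed.

Lemma eq_pair_set (T : finType) (a b c d : T) :
  [set a; b] = [set c; d] -> (a = c /\ b = d) \/ (a = d /\ b = c).
Proof.
move=> h.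
have : a \in [set c; d] by rewrite -h !inE eqxx.
have : b \in [set c; d] by rewrite -h !inE eqxx orbT.
have : c \in [set a; b] by rewrite h !inE eqxx.
have : d \in [set a; b] by rewrite h !inE eqxx orbT.
rewrite !inE => /orP[]/eqP e1 /orP[]/eqP e2 /orP[]/eqP e3 /orP[]/eqP e4;
  by subst; auto.
Qed.

Section Instance.
Variables (n : nat) (w : instance n).
Hypothesis n4 : 4 <= n.

Definition zero_positions (s : {perm 'I_n}) : {set 'I_n} :=
  [set i | ~~ w [set s i; s (ordS i)]].

(** Distinct positions give distinct edges: a coincidence would make some position its own second
    successor. So smaller weight means more zero positions. *)
Lemma wt_cycle_edges (s : {perm 'I_n}) :
  wt w (cycle_edges s) + #|zero_positions s| = n.
Proof.
rewrite /wt /cycle_edges big_imset /=; last first.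
  move=> i j _ _ /eq_pair_set [[/perm_inj //]|[/perm_inj e1 /perm_inj e2]].
  by have := ordSS_neq n4 j; rewrite -e1 e2 eqxx.
rewrite -[RHS](card_ord n) -sum1_card -sum1_card [X in _ + X]big_mkcond -big_split /=.
by apply: eq_bigr => i _; rewrite inE; case: (w _).
Qed.

Definition zedge (x y : 'I_n) : bool := (x != y) && ~~ w [set x; y].

Lemma zadj_ord (x y : 'I_n) : zadj w x y = zedge x y.
Proof.
rewrite /zadj /zedge val_eqE; case: eqVneq => //= xy; congr negb.
apply/existsP/idP => [[x' /existsP[y' /and4P[/eqP/val_inj-> /eqP/val_inj-> _ //]]]|wxy].
by exists x; apply/existsP; exists y; rewrite !eqxx xy wxy.
Qed.

Lemma perm_of_seq (T : seq nat) : perm_eq T (iota 0 n) ->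
  exists s : {perm 'I_n}, forall k : 'I_n, val (s k) = nth 0 T k.
Proof.
move=> pT; have sT : size T = n by rewrite (perm_size pT) size_iota.
have uT : uniq T by rewrite (perm_uniq pT) iota_uniq.
have bT (k : 'I_n) : nth 0 T k < n.
  have : nth 0 T k \in iota 0 n by rewrite -(perm_mem pT) mem_nth ?sT.
  by rewrite mem_iota.
pose f k : 'I_n := Ordinal (bT k).
have fi : injective f.
  move=> i j /(congr1 val) /= /eqP; rewrite nth_uniq ?sT // => /eqP.
  exact: val_inj.
by exists (perm fi) => k; rewrite permE.
Qed.

Lemma zeros_along_sum (Z : rel nat) T :
  zeros_along Z T = \sum_(i < (size T).-1) Z (nth 0 T i) (nth 0 T i.+1).
Proof.
elim: T => [|x T IH]; first by rewrite big_ord0.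
case: T IH => [|y T] IH; first by rewrite big_ord0.
by rewrite /= big_ord_recl; congr addn; apply: IH.
Qed.

(** Only an inequality, because the list ignores the closing edge from its last vertex to its
    first. *)
Lemma zeros_along_le (T : seq nat) (s : {perm 'I_n}) :
  perm_eq T (iota 0 n) -> (forall k : 'I_n, val (s k) = nth 0 T k) ->
  zeros_along (zadj w) T <= #|zero_positions s|.
Proof.
move=> pT hs; have sT : size T = n by rewrite (perm_size pT) size_iota.
rewrite zeros_along_sum sT.
have lt1 (i : 'I_n.-1) : i < n by have := ltn_ord i; lia.
pose f (i : 'I_n.-1) : 'I_n := Ordinal (lt1 i).
have fi : injective f by move=> i j /(congr1 val) /= /val_inj.
have fS i : val (ordS (f i)) = i.+1.
  by rewrite val_ordS /=; have := ltn_ord i; case: eqP => //; lia.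
apply: (@leq_trans #|[set i | f i \in zero_positions s]|).
  rewrite -sum1_card [X in _ <= X]big_mkcond /=; apply: leq_sum => i _.
  have := zadj_ord (s (f i)) (s (ordS (f i))); rewrite !hs fS /= => ->.
  by rewrite /zedge !inE; case: (~~ w _); rewrite ?andbF ?leq_b1.
rewrite -(card_imset _ fi); apply: subset_leq_card; apply/subsetP => j.
by case/imsetP => i; rewrite inE => hi ->.
Qed.

Lemma all_pairs_nth (Z : rel nat) Q : all_pairs Z Q ->
  ~~ odd (size Q) /\
  forall i, i.*2.+1 < size Q -> Z (nth 0 Q i.*2) (nth 0 Q i.*2.+1).
Proof.
have [k] := ubnP (size Q); elim: k Q => // k IH [|x [|y Q]] //= sQ /andP[Zxy aQ].
have [|oQ hQ] := IH Q _ aQ; first by lia.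
split=> [|[|i] //=]; first by rewrite negbK.
by rewrite !ltnS => lt_i; apply: hQ; lia.
Qed.

Lemma sum_ltn_const l m : \sum_(i < m) (i < l : nat) = minn l m.
Proof.
elim: m => [|m IH]; first by rewrite big_ord0 minn0.
by rewrite big_ord_recr /= IH; case: (ltnP m l); lia.
Qed.

(** List the vertices of [Q] first, then all others, and join them two by two; the first
    [(size Q)./2] edges have weight 0. This makes condition (ii) applicable to partial matchings. *)
Lemma pairing_matching Q : pairing n (zadj w) Q ->
  exists2 M, optimal_matching M & (wt w M).*2 + size Q <= (n./2).*2.
Proof.
move=> [uQ bQ /all_pairs_nth [oQ hQ]].
pose T := Q ++ [seq v <- iota 0 n | v \notin Q].
have pT : perm_eq T (iota 0 n).
  apply: uniq_perm; last 1 first.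
  - move=> v; rewrite mem_cat mem_filter mem_iota add0n /=.
    by case: (boolP (v \in Q)) => //= /(allP bQ) ->.
  - rewrite cat_uniq uQ filter_uniq ?iota_uniq // andbT.
    by apply/hasPn => v; rewrite mem_filter => /andP[].
  - exact: iota_uniq.
have sQ : size Q <= n.
  by rewrite -[X in _ <= X](size_iota 0) -(perm_size pT) size_cat leq_addr.
have [s hs] := perm_of_seq pT.
have lta (i : 'I_n./2) : i.*2 < n by have := ltn_ord i; lia.
have ltb (i : 'I_n./2) : i.*2.+1 < n by have := ltn_ord i; lia.
pose a i : 'I_n := Ordinal (lta i); pose b i : 'I_n := Ordinal (ltb i).
pose e i := [set s (a i); s (b i)].
have ab i j : a i != b j by rewrite -val_eqE /=; lia.
have disj i j : i != j -> [disjoint e i & e j].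
  move=> ij; rewrite -setI_eq0; apply/eqP/setP => x; rewrite !inE.
  have aij : a i != a j by move: ij; rewrite -!val_eqE /=; lia.
  have bij : b i != b j by move: ij; rewrite -!val_eqE /=; lia.
  apply/negP => /andP[/orP[]/eqP-> /orP[]]; rewrite (inj_eq perm_inj).
  - by rewrite (negPf aij).
  - by rewrite (negPf (ab i j)).
  - by rewrite eq_sym (negPf (ab j i)).
  - by rewrite (negPf bij).
have ei : injective e.
  move=> i j eij; apply/eqP/negPn/negP => /disj; rewrite eij -setI_eq0 setIid.
  by move/eqP/setP/(_ (s (a j))); rewrite !inE eqxx.
exists [set e i | i : 'I_n./2].
  split; last split.
  - move=> _ /imsetP[i _ ->]; rewrite /is_edge /e cards2 (inj_eq perm_inj).
    by rewrite ab.
  - by rewrite card_imset // card_ord.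
  - move=> _ _ /imsetP[i _ ->] /imsetP[j _ ->] h; apply: disj.
    by apply: contraNneq h => ->.
have -> : wt w [set e i | i : 'I_n./2] = \sum_(i < n./2) w (e i).
  by rewrite /wt big_imset /=; last by move=> i j _ _; apply: ei.
suff : \sum_(i < n./2) w (e i) + \sum_(i < n./2) (i < (size Q)./2 : nat) <= n./2.
  by rewrite sum_ltn_const; lia.
rewrite -big_split /= -[X in _ <= X](card_ord n./2) -sum1_card.
apply: leq_sum => i _; case: (ltnP i (size Q)./2) => hi; last first.
  by rewrite addn0 leq_b1.
have hi' : i.*2.+1 < size Q by lia.
have := zadj_ord (s (a i)) (s (b i)); rewrite !hs /= !nth_cat hi' (ltnW hi') hQ //.
by move=> /esym /andP[_ /negPf ->].
Qed.

Definition zero_edges : {set {set 'I_n}} := [set e | is_edge e && ~~ w e].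

Lemma card_zero_edges : wK w + #|zero_edges| = 'C(n, 2).
Proof.
have := card_draws 'I_n 2; rewrite card_ord => <-.
rewrite /wK -!sum1_card [X in X + _]big_mkcond [X in _ + X]big_mkcond.
rewrite [RHS]big_mkcond -big_split /=; apply: eq_bigr => e _.
by rewrite !inE /is_edge; case: (#|e| == 2); case: (w e).
Qed.

Lemma count_iota_ord (P : pred nat) : count P (iota 0 n) = #|[set x : 'I_n | P x]|.
Proof.
rewrite -sum1_card -sum1_count -val_enum_ord big_map big_enum_cond /=.
by apply: eq_bigl => x; rewrite !inE.
Qed.

Lemma deg_ord (x : 'I_n) : deg n (zadj w) x = #|[set y | zedge x y]|.
Proof.
rewrite /deg count_iota_ord; apply: eq_card => y; rewrite !inE; exact: zadj_ord.
Qed.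

Lemma card_mem_ord (Q : seq nat) : uniq Q -> all (fun v => v < n) Q ->
  #|[set x : 'I_n | val x \in Q]| = size Q.
Proof.
move=> uQ bQ; rewrite -count_iota_ord -size_filter; apply: perm_size.
apply: uniq_perm => //; first by rewrite filter_uniq ?iota_uniq.
move=> v; rewrite mem_filter mem_iota add0n /=.
by apply/andP/idP => [[]//|vQ]; split=> //; apply: (allP bQ).
Qed.

Lemma zedge_sym x y : zedge x y = zedge y x.
Proof. by rewrite /zedge eq_sym setUC. Qed.

(** * Zero edges split by the high vertices [S] and a cover [C] of the rest *)

Section Split.
Variables (D : nat) (S C : {set 'I_n}).
Hypothesis lowS : forall x, x \notin S -> #|[set y | zedge x y]| <= D.
Hypothesis coverC : forall x y, x \notin S -> y \notin S -> zedge x y ->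
  (x \in C) || (y \in C).

Definition low_edge (x y : 'I_n) : bool := [&& x \notin S, y \notin S & zedge x y].

Lemma low_edge_sym x y : low_edge x y = low_edge y x.
Proof. by rewrite /low_edge zedge_sym andbCA. Qed.

Lemma low_edge_deg x : #|[set y | low_edge x y]| <= D.
Proof.
case: (boolP (x \in S)) => xS.
  rewrite (_ : [set _ | _] = set0) ?cards0 //.
  by apply/setP => y; rewrite !inE /low_edge xS.
apply: leq_trans (lowS xS); apply: subset_leq_card; apply/subsetP => y.
by rewrite !inE => /and3P[].
Qed.

Lemma card_arcs_from :
  #|[set p : 'I_n * 'I_n | (p.1 \in C) && low_edge p.1 p.2]| <= #|C| * D.
Proof.
rewrite -sum1_card (partition_big (fun p => p.1) (fun x => x \in C)); last first.
  by move=> p; rewrite inE => /andP[].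
rewrite -sum_nat_const; apply: leq_sum => x xC; apply: leq_trans (low_edge_deg x).
rewrite (reindex_onto (fun y => (x, y)) (fun p => p.2)) /=; last first.
  by move=> [x' y'] /= /andP[_ /eqP->].
rewrite -sum1_card; apply: eq_leq; apply: eq_bigl => y.
by rewrite !inE /= xC !eqxx !andbT.
Qed.

Lemma arcs_le : arcs low_edge <= 2 * #|C| * D.
Proof.
pose F := [set p : 'I_n * 'I_n | (p.1 \in C) && low_edge p.1 p.2].
pose sw (p : 'I_n * 'I_n) := (p.2, p.1).
have leF : #|F| <= #|C| * D := card_arcs_from.
have leF' : #|sw @: F| <= #|F| := leq_imset_card _ _.
have : arcs low_edge <= #|F :|: sw @: F|.
  apply: subset_leq_card; apply/subsetP => -[x y]; rewrite !inE /= => exy.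
  have /and3P[xS yS zxy] := exy.
  have /orP[xC|yC] := coverC xS yS zxy; first by rewrite xC exy.
  apply/orP; right; apply/imsetP; exists (y, x) => //.
  by rewrite inE /= yC low_edge_sym.
move=> h; have := (leq_card_setU F (sw @: F)).1; move: h leF leF'; lia.
Qed.

(** A high vertex accounts for at most two positions, its own and the preceding one; any other zero
    position is a low arc. *)
Lemma zero_positions_le (s : {perm 'I_n}) :
  #|zero_positions s| <= 2 * #|S| + #|arcs_along low_edge s|.
Proof.
pose A := [set i | s i \in S]; pose B := [set i | s (ordS i) \in S].
have cA : #|A| <= #|S|.
  rewrite -(card_imset _ (@perm_inj _ s)); apply: subset_leq_card.
  by apply/subsetP => x /imsetP[i]; rewrite inE => hi ->.
have cB : #|B| <= #|S|.
  have ij : injective (fun i => s (ordS i)) by apply: inj_comp (@ordS_inj_n n); apply: perm_inj.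
  rewrite -(card_imset _ ij); apply: subset_leq_card.
  by apply/subsetP => x /imsetP[i]; rewrite inE => hi ->.
have : #|zero_positions s| <= #|A :|: B :|: arcs_along low_edge s|.
  apply: subset_leq_card; apply/subsetP => i; rewrite !inE => wi.
  rewrite /low_edge /zedge wi andbT (inj_eq perm_inj) eq_sym (ordS_neq n4).
  by case: (s i \in S); case: (s (ordS i) \in S).
move=> h; apply: leq_trans h (leq_trans (leq_card_setU _ _).1 _).
rewrite leq_add2r; apply: leq_trans (leq_card_setU _ _).1 _.
by rewrite mul2n -addnn leq_add.
Qed.

Lemma card_zero_edges_le : #|zero_edges| <= #|S| * n.-1 + #|C| * D.
Proof.
pose F := [set p : 'I_n * 'I_n | (p.1 \in C) && low_edge p.1 p.2].
pose G := [set p : 'I_n * 'I_n | (p.1 \in S) && (p.2 != p.1)].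
pose h (p : 'I_n * 'I_n) := [set p.1; p.2].
have cG : #|G| <= #|S| * n.-1.
  rewrite -sum1_card (partition_big (fun p => p.1) (fun x => x \in S)); last first.
    by move=> p; rewrite inE => /andP[].
  rewrite -sum_nat_const; apply: leq_sum => x xS.
  rewrite (reindex_onto (fun y => (x, y)) (fun p => p.2)) /=; last first.
    by move=> [x' y'] /= /andP[_ /eqP->].
  rewrite -[n.-1](_ : #|[set~ x]| = _); last by rewrite cardsC1 card_ord.
  rewrite -sum1_card; apply: eq_leq; apply: eq_bigl => y.
  by rewrite !inE /= xS !eqxx !andbT.
have : #|zero_edges| <= #|h @: G :|: h @: F|.
  apply: subset_leq_card; apply/subsetP => e; rewrite !inE.
  case/andP=> /cards2P [x [y [xy ->]]] wxy.
  case: (boolP (x \in S)) => xS.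
    apply/orP; left; apply/imsetP; exists (x, y) => //.
    by rewrite inE /= xS eq_sym.
  case: (boolP (y \in S)) => yS.
    apply/orP; left; apply/imsetP; exists (y, x); last by rewrite /h setUC.
    by rewrite inE /= yS.
  have zxy : zedge x y by rewrite /zedge xy.
  have exy : low_edge x y by rewrite /low_edge xS yS.
  apply/orP; right; apply/imsetP; have /orP[xC|yC] := coverC xS yS zxy.
    by exists (x, y) => //; rewrite inE /= xC exy.
  by exists (y, x); rewrite /h /= ?(setUC [set y]) // inE /= yC low_edge_sym.
have := (leq_card_setU (h @: G) (h @: F)).1.
have := leq_imset_card h G; have := leq_imset_card h F.
have : #|F| <= #|C| * D := card_arcs_from.
lia.
Qed.

End Split.

Lemma pairing_even Q : pairing n (zadj w) Q -> ~~ odd (size Q).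
Proof. by case=> _ _ /all_pairs_nth[]. Qed.

Definition better_orderings (s0 : {perm 'I_n}) : {set {perm 'I_n}} :=
  [set s | #|zero_positions s0| < #|zero_positions s| ].

(** Here [c] is 2g and [h] is |S|. The case [c = 0] is separate because the moment bound divides by
    g (g + 1); then no zero edge avoids S and nothing beats the tour. *)
Lemma tour_success_bound D (s0 : {perm 'I_n}) :
  defect n (zadj w) D = 0 ->
  (forall k : 'I_n, val (s0 k) = nth 0 (tour n (zadj w) D) k) ->
  exists c h, [/\ exists2 Q, pairing n (zadj w) Q & size Q = c + h.*2,
    ~~ odd c, #|zero_edges| <= h * n.-1 + c * D &
    let B := #|better_orderings s0| in
    if c == 0 then B = 0 else B * ((n - 1) * (n - 2)) <= 16 * (D * D) * n`!].
Proof.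
move=> dD hs0.
have [pM cM exQ leZ] := tour_success (@zadj_irr n w) (@zadj_sym n w) dD.
have pT := tour_perm n (@zadj_irr n w) D.
set c := size (matching_phase n (zadj w) D) in exQ leZ *.
set h := high_below n (zadj w) D n in exQ leZ *.
pose S : {set 'I_n} := [set x : 'I_n | ~~ low n (zadj w) D x].
pose C : {set 'I_n} := [set x : 'I_n | val x \in matching_phase n (zadj w) D].
have cS : #|S| = h by rewrite /h /high_below count_iota_ord.
have cC : #|C| = c by case: pM => uM bM _; rewrite card_mem_ord.
have lowS (x : 'I_n) : x \notin S -> #|[set y | zedge x y]| <= D.
  by rewrite inE negbK -deg_ord => /ltnW.
have coverC (x y : 'I_n) : x \notin S -> y \notin S -> zedge x y ->
    (x \in C) || (y \in C).
  rewrite !inE !negbK -zadj_ord => lx ly zxy.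
  exact: (cM x y (ltn_ord x) (ltn_ord y) lx ly zxy).
have ec := pairing_even pM.
exists c, h; split=> //; first by rewrite -cS -cC; apply: card_zero_edges_le.
have z0 : c + 4 * h <= 2 * #|zero_positions s0|.
  by rewrite mul2n; apply: leq_trans leZ _; rewrite leq_double zeros_along_le.
have many (s : {perm 'I_n}) : #|zero_positions s0| < #|zero_positions s| ->
    c./2 < #|arcs_along (low_edge S) s|.
  move=> lt_z; have := zero_positions_le S s; rewrite cS.
  by move: z0 lt_z; lia.
have sub : better_orderings s0 \subset
    [set s | c./2 < #|arcs_along (low_edge S) s| ].
  by apply/subsetP => s; rewrite !inE; apply: many.
have leA := arcs_le lowS coverC; rewrite cC in leA.
cbv zeta; case: eqP => [c0|/eqP c0].
  apply/eqP; rewrite cards_eq0 -subset0; apply: subset_trans sub _.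
  apply/subsetP => s; rewrite !inE c0 /= => /card_gt0P[i]; rewrite inE => ei.
  have : 0 < arcs (low_edge S).
    by apply/card_gt0P; exists (s i, s (ordS i)); rewrite inE.
  by move: leA; rewrite c0 muln0; lia.
apply: leq_trans (leq_mul (subset_leq_card sub) (leqnn _)) _.
apply: card_many_arcs => //; first by move=> x; apply: low_edge_deg.
  by move: c0 ec; rewrite /c; lia.
apply: leq_trans leA _; rewrite leq_mul2r; apply/orP; right.
by move: ec; rewrite -/c; lia.
Qed.

End Instance.

(** * Dense instances *)

(** The roles are db = 1 - d, N = n^(1/2 - eps) and q = n^(-2 eps). The main part of D is (5/2) db
    n, whose square is at most of order n N. *)
Lemma threshold_bound (n D c h db r N q : R) :
  (16 <= n -> 0 <= db <= 1/12 -> 0 < r -> 0 <= D -> 2 <= c -> 0 <= h ->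
   2 * D <= 5 * (db * n + 2 * r) + 2 -> c + 2 * h <= db * n + 2 * r ->
   db * n * (n - 1) / 2 <= h * (n - 1) + c * D ->
   6 * db ^ 2 * n + 46 * r <= N -> N * N = n * q -> N * N <= n ->
   16 * (D * D) <= 6 * q * ((n - 1) * (n - 2)))%R.
Proof.
move=> hn [db0 db1] r0 D0 c2 h0 hD hch he hN Nq Nn.
have N0 : (0 < N)%R by have := pow2_ge_0 db; nra.
have N4 : (N <= n / 4)%R by nra.
(* Twice the edge count is compared with n - 1 times the matching bound; the terms in [h] and [db]
   cancel. *)
have key : (c * (n - 1 - 2 * D) <= 2 * r * (n - 1))%R by nra.
have r46 : (46 * r <= N)%R by nra.
have hD2 : (2 * D <= 5/12 * n + 10/184 * n + 2)%R by nra.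
(* The coefficient of n is about 0.529; n >= 16 pays for the constant 3. With c >= 2 this gives r >=
   0.34. *)
have gap : (34/100 * n <= n - 1 - 2 * D)%R by lra.
have r3 : (1/3 <= r)%R by nra.
have N15 : (15 <= N)%R by lra.
(* 5 r <= (5/46) N and 1 <= N/15, and 5/46 + 1/15 < 0.18. *)
have D1 : (D <= 5/2 * (db * n) + 18/100 * N)%R by lra.
have dn : (6 * (db * n) * (db * n) <= n * N)%R.
  have : (n * (6 * db ^ 2 * n) <= n * N)%R by apply: Rmult_le_compat_l; lra.
  lra.
(* This is (a + b)^2 <= 2 a^2 + 2 b^2. *)
have DD : (D * D <= 25/2 * (db * n * (db * n)) + 648/10000 * (N * N))%R.
  have x0 : (0 <= db * n)%R by nra.
  have D2 := Rmult_le_compat _ _ _ _ D0 D0 D1 D1.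
  have := Rle_0_sqr (5/2 * (db * n) - 18/100 * N)%R; rewrite /Rsqr; lra.
have n0 : (0 <= n)%R by lra.
have nN : (15 * (n * N) <= n * (N * N))%R.
  have : (n * (15 * N) <= n * (N * N))%R.
    by apply: Rmult_le_compat_l => //; apply: Rmult_le_compat_r; lra.
  lra.
have NN0 : (0 <= N * N)%R by apply: Rmult_le_pos; lra.
have NN : (16 * (N * N) <= n * (N * N))%R by apply: Rmult_le_compat_r.
have q0 : (0 <= q)%R.
  by apply: (Rmult_le_reg_l n); rewrite ?Rmult_0_r -?Nq //; lra.
have nNN0 : (0 <= n * (N * N))%R by apply: Rmult_le_pos.
(* 25/2 * 1/6 * 1/15 + 0.0648/16 < 0.143. *)
have DD2 : (D * D <= 143/1000 * (n * (n * q)))%R by rewrite -Nq; lra.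
(* 210/256 is (15/16) (14/16), the value of the ratio at n = 16. *)
have nn : (210/256 * (n * n) <= (n - 1) * (n - 2))%R by nra.
have : (q * (210/256 * (n * n)) <= q * ((n - 1) * (n - 2)))%R.
  exact: Rmult_le_compat_l.
have : (0 <= q * (n * n))%R by apply: Rmult_le_pos => //; apply: Rmult_le_pos.
lra.
Qed.

Lemma INR_addn (a b : nat) : INR (a + b)%N = (INR a + INR b)%R.
Proof. exact: plus_INR. Qed.

Lemma INR_muln (a b : nat) : INR (a * b)%N = (INR a * INR b)%R.
Proof. exact: mult_INR. Qed.

Lemma INR_leq (a b : nat) : (a <= b)%N -> (INR a <= INR b)%R.
Proof. by move=> /leP; apply: le_INR. Qed.

Lemma INR_pred (a : nat) : (0 < a)%N -> INR a.-1 = (INR a - 1)%R.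
Proof. by case: a => // a _; rewrite S_INR /=; lra. Qed.

Section Dense.
Variables (n : nat) (w : instance n) (d r eps : R).
Hypothesis hdense : dense w d r eps.

Local Notation nR := (INR n).
Local Notation N := (Rpower nR (1 / 2 - eps)).
Local Notation q := (Rpower nR (-2 * eps)).

Lemma dense_pairing Q :
  pairing n (zadj w) Q -> (INR (size Q) <= (1 - d) * nR + 2 * r)%R.
Proof.
have [n4 [_ [_ [_ [_ [_ [hM _]]]]]]] := hdense.
case/(pairing_matching n4) => M /hM wM.
rewrite -addnn => le_n.
have /INR_leq : (wt w M + wt w M + size Q <= n)%N by lia.
by rewrite !INR_addn; lra.
Qed.

Lemma dense_zero_edges :
  INR #|zero_edges w| = ((1 - d) * nR * (nR - 1) / 2)%R.
Proof.
have [n4 [_ [_ [_ [hK _]]]]] := hdense.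
have e2 := congr1 INR (bin_ffact n 2).
rewrite ffactnS ffactn1 !INR_muln INR_pred in e2; last by lia.
have -> : #|zero_edges w| = ('C(n, 2) - wK w)%N.
  by rewrite -(card_zero_edges w) addKn.
rewrite minus_INR; last by rewrite -(card_zero_edges w); apply/leP; apply: leq_addr.
have EC : INR 'C(n, 2) = (nR * (nR - 1) / 2)%R.
  by move: e2; rewrite [INR 2]/= [INR 1]/=; lra.
by rewrite hK EC; field.
Qed.

Lemma dense_scale : (N * N = nR * q)%R /\ (N * N <= nR)%R.
Proof.
have [n4 [_ [_ [[eps0 _] _]]]] := hdense.
have n1 : (1 < nR)%R by apply: (lt_INR 1); apply/ltP; lia.
have e : (N * N = Rpower nR (1 + -2 * eps))%R.
  by rewrite -Rpower_plus; congr Rpower; field.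
split; first by rewrite e Rpower_plus Rpower_1 //; lra.
rewrite e -[X in (_ <= X)%R]Rpower_1; last by lra.
by apply: Rle_Rpower; lra.
Qed.

(** A single zero edge is a matching on two vertices, but (1 - d) n + 2 r <= 15/12 + 8/46 < 2. *)
Lemma dense_small : (n < 16)%N -> zero_edges w = set0.
Proof.
have [n4 [r0 [[d0 d1] [_ [_ [db [_ hN]]]]]]] := hdense.
move=> n16; apply/eqP; rewrite -subset0; apply/subsetP => e; rewrite inE.
case/andP=> /cards2P [x [y [xy ->]]] wxy; exfalso.
have pQ : pairing n (zadj w) [:: val x; val y].
  by split; rewrite /= ?inE ?andbT ?val_eqE ?xy ?ltn_ord // zadj_ord /zedge xy.
have := dense_pairing pQ; rewrite [INR _]/=.
have [_ NN] := dense_scale.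
have nR16 : (nR <= 15)%R.
  by have -> : 15%R = INR 15 by [rewrite /=; lra]; apply: INR_leq.
have nR0 : (0 <= nR)%R := pos_INR n.
have N4 : (N <= 4)%R by have := exp_pos ((1/2 - eps) * ln nR); rewrite -/(Rpower _ _); nra.
have : (0 <= 6 * (1 - d) ^ 2 * (nR + 1))%R.
  by apply: Rmult_le_pos; [have := pow2_ge_0 (1 - d)|]; lra.
have : ((1 - d) * nR <= 1 / 12 * 15)%R by apply: Rmult_le_compat; lra.
lra.
Qed.

Lemma dense_domination (s0 : {perm 'I_n}) :
  (INR #|better_orderings w s0| <= 6 * q * INR n`!)%R ->
  domination_ratio_ge w (cycle_edges s0) (1 - 6 * q)%R.
Proof.
have [n4 _] := hdense.
set B := better_orderings w s0 => leB; rewrite /domination_ratio_ge.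
have := ham_cycles_fraction (fun H => (wt w H < wt w (cycle_edges s0))%N).
have -> : [set s : {perm 'I_n} | (wt w (cycle_edges s) < wt w (cycle_edges s0))%N] = B.
  apply/setP => s; rewrite !inE.
  by have := wt_cycle_edges w n4 s; have := wt_cycle_edges w n4 s0; lia.
move=> /(congr1 INR); rewrite !INR_muln => e.
have h0 : (0 < INR #|ham_cycles n|)%R.
  by apply: (lt_INR 0); apply/ltP; apply: card_ham_cycles_gt0.
have f0 : (0 < INR n`!)%R by apply: (lt_INR 0); apply/ltP; apply: fact_gt0.
have -> : (1 - (1 - 6 * q) = 6 * q)%R by lra.
apply: (Rmult_le_reg_r (INR #|ham_cycles n|)) => //.
apply: (Rmult_le_reg_r (INR n`!)) => //.
have divK x : (x / INR #|ham_cycles n| * INR #|ham_cycles n| = x)%R by field; lra.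
rewrite divK e.
have -> : forall x y z : R, (x * y * z = x * z * y)%R by move=> *; ring.
by apply: Rmult_le_compat_r => //; apply: Rlt_le.
Qed.

Lemma greedy_domination D (s0 : {perm 'I_n}) : (16 <= n)%N ->
  defect n (zadj w) D = 0 ->
  (forall D', (D' < D)%N -> defect n (zadj w) D' <> 0) ->
  (forall k : 'I_n, val (s0 k) = nth 0 (tour n (zadj w) D) k) ->
  domination_ratio_ge w (cycle_edges s0) (1 - 6 * q)%R.
Proof.
move=> n16 dD minD hs0; apply: dense_domination.
have [n4 [r0 [[d0 d1] [_ [_ [db [_ hN]]]]]]] := hdense.
have [c [h [[Q pQ sQ] oc le_e]]] := tour_success_bound n4 dD hs0.
set B := #|_|; cbv zeta.
have f0 : (0 < INR n`!)%R by apply: (lt_INR 0); apply/ltP; apply: fact_gt0.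
have q0 : (0 < q)%R by apply: exp_pos.
case: eqP => [_ -> |/eqP c0 leB].
  by apply: Rmult_le_pos; rewrite /=; lra.
have nR16 : (16 <= nR)%R.
  by have -> : 16%R = INR 16 by [rewrite /=; lra]; apply: INR_leq.
have c2 : (2 <= INR c)%R.
  by have -> : 2%R = INR 2 by [rewrite /=; lra]; apply: INR_leq; lia.
have hD : (2 * INR D <= 5 * ((1 - d) * nR + 2 * r) + 2)%R.
  (* D = 0 has no failed predecessor, but there the bound is trivial. *)
  case: (D) minD => [_|D' minD].
    have : (0 <= (1 - d) * nR)%R by apply: Rmult_le_pos; lra.
    by rewrite [INR 0]/=; lra.
  have [Q1 [Q2 [p1 p2]]] :=
    tour_failure (@zadj_irr n w) (@zadj_sym n w) (minD D' (leqnn _)).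
  move=> /INR_leq; rewrite -addnn (INR_addn D') (INR_addn (3 * size Q1)%N).
  rewrite (INR_muln 3) (INR_muln 2).
  have := dense_pairing p1; have := dense_pairing p2.
  by rewrite (S_INR D') [INR 3]/= [INR 2]/=; lra.
have hch := dense_pairing pQ.
rewrite sQ -addnn !INR_addn in hch.
move/INR_leq: le_e; rewrite dense_zero_edges INR_addn !INR_muln INR_pred; last by lia.
move=> he; have [NNq NNn] := dense_scale.
have hN' : (6 * (1 - d) ^ 2 * nR + 46 * r <= N)%R.
  by have := pow2_ge_0 (1 - d); lra.
have key : (16 * (INR D * INR D) <= 6 * q * ((nR - 1) * (nR - 2)))%R.
  apply: (@threshold_bound nR (INR D) (INR c) (INR h) (1 - d) r N q) => //;
    try exact: pos_INR; try lra.
move/INR_leq: leB.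
rewrite (INR_muln B) (INR_muln (n - 1)%N) (INR_muln (16 * _)%N) (INR_muln 16).
rewrite (INR_muln D).
have -> : INR (n - 1) = (nR - 1)%R by rewrite minus_INR //; apply/leP; lia.
have -> : INR (n - 2) = (nR - 2)%R by rewrite minus_INR //; apply/leP; lia.
have -> : INR 16 = 16%R by rewrite /=; lra.
move=> leB.
have p0 : (0 < (nR - 1) * (nR - 2))%R by apply: Rmult_lt_0_compat; lra.
apply: (Rmult_le_reg_r _ _ _ p0); apply: Rle_trans leB _.
have := Rmult_le_compat_r _ _ _ (Rlt_le _ _ f0) key; lra.
Qed.

End Dense.

Theorem theorem5p10 :
  exists (P : program) (C : nat),
    forall (n : nat) (w : instance n),
      (4 <= n)%nat ->
      exists H : {set {set 'I_n}},
        outputs_within P w (C * n ^ 4) H /\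
        forall d r eps : R,
          dense w d r eps ->
          domination_ratio_ge w H (1 - 6 * Rpower (INR n) (-2 * eps))%R.
Proof.
(* The factor 16 comes from (n + 2)^4 <= (2 n)^4. *)
exists (compile 0 tsp_code), (weight tsp_code * 16) => n w n4.
have cost_n : (cost n tsp_code <= weight tsp_code * 16 * n ^ 4)%nat.
  apply: leq_trans (cost_le n tsp_code) _.
  rewrite depth_tsp_code -mulnA leq_mul2l; apply/orP; right.
  have -> : (16 * n ^ 4)%nat = expn (2 * n)%N 4 by rewrite !expnS expn0 /=; lia.
  by rewrite leq_exp2r //; lia.
have [m' [run_m' [T [pT hT hD]]]] := wp_run (wp_tsp_code w n4) cost_n.
have [s hs] := perm_of_seq pT.
exists (cycle_edges s); split.
  rewrite /outputs_within /init_state run_m'; split.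
    by rewrite /halted size_compile [pc _]/= ltnn.
  by exists s; split=> // k; rewrite hs; apply: hT.
move=> d r eps hd; case: (ltnP n 16) => n16.
  apply: (dense_domination hd).
  have z0 := dense_small hd n16.
  rewrite (_ : better_orderings w s = set0) ?cards0.
    apply: Rmult_le_pos; last exact: pos_INR.
    by have := exp_pos (-2 * eps * ln (INR n)); rewrite -/(Rpower _ _); lra.
  apply/setP => s1; rewrite !inE; apply/negbTE; rewrite -leqNgt.
  apply: leq_trans (leq0n _); rewrite leqn0 cards_eq0 -subset0.
  apply/subsetP => i; rewrite inE => wi; have := in_set0 [set s1 i; s1 (ordS i)].
  rewrite -z0 inE wi andbT /is_edge cards2 (inj_eq perm_inj).
  by rewrite [i == _]eq_sym (ordS_neq n4).
have [D [ET dD minD]] := hD n16.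
by apply: (greedy_domination hd n16 dD minD) => k; rewrite -ET.
Qed.
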